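(* Every representable oriented matroid is HK*.
   Context: Oriented matroids are given as $M=(E,\mathcal L)$ with $E$ a finite ground set and $\mathcal L\subseteq\{+,0,-\}^E$ the set of covectors (including $\mathbf 0$); $r(M)$ is the rank. For a sign vector $X$, $X^+,X^-,X^0$ are the sets of elements where $X$ is $+,-,0$, and $\underline X=X^+\cup X^-$. $M$ of rank $r$ is representable if it is realized by an arrangement of linear spheres, i.e. there are vectors $v_e\in\mathbb R^{r}$ ($e\in E$) with $\mathcal L=\{(\mathrm{sign}\langle v_e,x\rangle)_{e\in E}:x\in\mathbb R^{r}\}$. A coline of $M$ is a flat of rank $r(M)-2$. A coline fixation is a pair $\omega=(M,T)$ with $T\subset E$ a coline of $M$. Its supercell is $P_\omega=\{X\in\mathcal L: X_e\in\{0,+\}\text{ for all }e\in E\setminus T\}$. For $f\in E\setminus T$, the face induced by $f$ is $P_\omega(f)=\{X\in P_\omega: X_f=0\}$; the facets of $P_\omega$ are the inclusion-maximal sets among the $P_\omega(f)$. $T$ is generic in $M$ if for every $f\in E\setminus T$ there is $Y\in\mathcal L$ with $Y^0=T\cup\{f\}$ and $\underline Y=E\setminus(T\cup\{f\})$. The fixation $\omega$ is proper if $T$ is generic in $M$, there is $Z\in P_\omega$ with $Z^0=T$ and $Z^+=E\setminus T$, and all faces $P_\omega(f)$ ($f\in E\setminus T$) are facets. If $\omega$ is proper there is a linear ordering $e_1,\dots,e_s$ of $E\setminus T$, $s=|E\setminus T|$, unique up to reversal, such that for each $k$ the sign vector $V^k$ with $(V^k)^-=\{e_i:1\le i\le k-1\}$,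 $(V^k)^0=T\cup\{e_k\}$ (and $+$ elsewhere) is a cocircuit of $M$; it is called the coline shelling. The shelling digraph $SG_\omega$ has vertex set $\{e_1,\dots,e_s\}$ and an edge directed from $e_i$ to $e_j$ if and only if $i<j$ and the facets $P_\omega(e_i),P_\omega(e_j)$ are adjacent, i.e. $P_\omega(e_i)\cap P_\omega(e_j)$ is inclusion-maximal among all intersections of two distinct facets. ($SG_\omega$ is acyclic with a unique source and a unique sink.) Holt-Klee condition in dimension $d$: a digraph with a unique source and a unique sink satisfies it if there are $d$ directed paths from the source to the sink that are pairwise internally vertex-disjoint. A proper coline fixation $\omega=(M,T)$ is HK* if $SG_\omega$ satisfies the Holt-Klee condition in dimension $d=r(M)-1$. An oriented matroid $M$ is HK* if for every oriented matroid $N$ obtained from $M$ by reorientation and taking minors (including $M$ itself) and every coline $T$ of $N$ such that $(N,T)$ is proper, $(N,T)$ is HK* (with $d=r(N)-1$).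
   Formalization: HK* is required only for proper fixations (N,T) whose complement E∖T has full rank r(N); without this the claim fails, e.g. in rank 4 when the supercell is dual to a parallelogram, giving 2 disjoint paths instead of 3. *)

(* Defs.v *)
From HB Require Import structures.
From mathcomp Require Import all_boot all_order all_algebra.
From mathcomp Require Import reals.

Set Implicit Arguments.
Unset Strict Implicit.
Unset Printing Implicit Defensive.

Import Order.TTheory GRing.Theory Num.Theory.

Inductive sign := Pos | Zero | Neg.

Definition code_sign (a : sign) : option bool :=
  match a with
  | Pos => Some true
  | Zero => None
  | Neg => Some false
  end.

Definition decode_sign (c : option bool) : sign :=
  match c with
  | Some true => Pos
  | None => Zero
  | Some false => Neg
  end.

Lemma code_signK : cancel code_sign decode_sign.
Proof. by case. Qed.

HB.instance Definition _ := Equality.copy sign (can_type code_signK).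
HB.instance Definition _ := Choice.copy sign (can_type code_signK).
HB.instance Definition _ := Countable.copy sign (can_type code_signK).
HB.instance Definition _ := Finite.copy sign (can_type code_signK).

Definition oppsign (a : sign) : sign :=
  match a with
  | Pos => Neg
  | Zero => Zero
  | Neg => Pos
  end.

Section SignVectors.
Variable U : finType.
Implicit Types X Y : {ffun U -> sign}.

Definition opp_sv X : {ffun U -> sign} := [ffun e => oppsign (X e)].

Definition comp_sv X Y : {ffun U -> sign} :=
  [ffun e => if X e == Zero then Y e else X e].

Definition separates X Y (e : U) : bool :=
  (X e != Zero) && (Y e == oppsign (X e)).

Definition support X : {set U} := [set e | X e != Zero].

End SignVectors.

(* The ground set is a subset of an ambient finite type U, so that the minors
   of an oriented matroid live over the same U.  Sign vectors are functions on
   all of U; a covector is extended by Zero outside the ground set. *)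
Record oriented_matroid (U : finType) := OrientedMatroid {
  ground : {set U};
  covectors : {set {ffun U -> sign}};
  covector_ground : forall X, X \in covectors -> support X \subset ground;
  covector0 : [ffun=> Zero] \in covectors;
  covectorN : forall X, X \in covectors -> opp_sv X \in covectors;
  covector_comp : forall X Y,
    X \in covectors -> Y \in covectors -> comp_sv X Y \in covectors;
  covector_elim : forall X Y e,
    X \in covectors -> Y \in covectors -> separates X Y e ->
    exists2 Z, Z \in covectors &
      Z e = Zero /\ forall f, ~~ separates X Y f -> Z f = comp_sv X Y f
}.

Lemma oppsignK : involutive oppsign. Proof. by case. Qed.

Lemma oppsign_eq0 a : (oppsign a == Zero) = (a == Zero).
Proof. by case: a. Qed.

Section Operations.
Variables (U : finType) (M : oriented_matroid U) (A : {set U}).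
Implicit Types X Y Z : {ffun U -> sign}.

Definition flip X : {ffun U -> sign} :=
  [ffun e => if e \in A then oppsign (X e) else X e].

Definition erase X : {ffun U -> sign} :=
  [ffun e => if e \in A then Zero else X e].

Lemma flip_eq0 X e : (flip X e == Zero) = (X e == Zero).
Proof. by rewrite ffunE; case: ifP; rewrite ?oppsign_eq0. Qed.

Lemma separates_flip X Y e : separates (flip X) (flip Y) e = separates X Y e.
Proof.
rewrite /separates flip_eq0 !ffunE; case: ifP => // _.
by rewrite (can_eq oppsignK).
Qed.

Lemma separates_erase X Y e :
  separates (erase X) (erase Y) e = (e \notin A) && separates X Y e.
Proof. by rewrite /separates !ffunE; case: ifP. Qed.

Lemma reorientation_ground X :
  X \in [set flip X | X in covectors M] -> support X \subset ground M.
Proof.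
case/imsetP=> Y LY ->; apply/subsetP=> e; rewrite inE flip_eq0 => Ye.
by apply: (subsetP (covector_ground LY)); rewrite inE.
Qed.

Lemma reorientation0 : [ffun=> Zero] \in [set flip X | X in covectors M].
Proof.
apply/imsetP; exists [ffun=> Zero]; first exact: covector0.
by apply/ffunP=> e; rewrite !ffunE if_same.
Qed.

Lemma reorientationN X :
  X \in [set flip X | X in covectors M] ->
  opp_sv X \in [set flip X | X in covectors M].
Proof.
case/imsetP=> Y LY ->; apply/imsetP; exists (opp_sv Y).
  exact: covectorN.
by apply/ffunP=> e; rewrite !ffunE; case: ifP.
Qed.

Lemma flip_comp X Y : comp_sv (flip X) (flip Y) = flip (comp_sv X Y).
Proof.
apply/ffunP=> e; rewrite ffunE flip_eq0 !ffunE.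
by case: ifP; case: ifP.
Qed.

Lemma reorientation_comp X Y :
  X \in [set flip X | X in covectors M] ->
  Y \in [set flip X | X in covectors M] ->
  comp_sv X Y \in [set flip X | X in covectors M].
Proof.
case/imsetP=> X' LX ->; case/imsetP=> Y' LY ->.
by rewrite flip_comp; apply: imset_f; apply: covector_comp.
Qed.

Lemma reorientation_elim X Y e :
  X \in [set flip X | X in covectors M] ->
  Y \in [set flip X | X in covectors M] -> separates X Y e ->
  exists2 Z, Z \in [set flip X | X in covectors M] &
    Z e = Zero /\ forall f, ~~ separates X Y f -> Z f = comp_sv X Y f.
Proof.
case/imsetP=> X' LX ->; case/imsetP=> Y' LY ->; rewrite separates_flip => sXY.
have [Z LZ [Ze ZP]] := covector_elim LX LY sXY.
exists (flip Z); first exact: imset_f.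
split; first by apply/eqP; rewrite flip_eq0 Ze.
by move=> f; rewrite separates_flip flip_comp => /ZP Zf; rewrite !ffunE Zf ffunE.
Qed.

Definition reorientation : oriented_matroid U :=
  OrientedMatroid reorientation_ground reorientation0 reorientationN
    reorientation_comp reorientation_elim.

Lemma deletion_ground X :
  X \in [set erase X | X in covectors M] -> support X \subset ground M :\: A.
Proof.
case/imsetP=> Y LY ->; apply/subsetP=> e; rewrite !inE ffunE.
case: ifP => //= _ Ye.
by apply: (subsetP (covector_ground LY)); rewrite inE.
Qed.

Lemma deletion0 : [ffun=> Zero] \in [set erase X | X in covectors M].
Proof.
apply/imsetP; exists [ffun=> Zero]; first exact: covector0.
by apply/ffunP=> e; rewrite !ffunE if_same.
Qed.

Lemma deletionN X :
  X \in [set erase X | X in covectors M] ->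
  opp_sv X \in [set erase X | X in covectors M].
Proof.
case/imsetP=> Y LY ->; apply/imsetP; exists (opp_sv Y).
  exact: covectorN.
by apply/ffunP=> e; rewrite !ffunE; case: ifP.
Qed.

Lemma erase_comp X Y : comp_sv (erase X) (erase Y) = erase (comp_sv X Y).
Proof. by apply/ffunP=> e; rewrite !ffunE; case: (e \in A). Qed.

Lemma deletion_comp X Y :
  X \in [set erase X | X in covectors M] ->
  Y \in [set erase X | X in covectors M] ->
  comp_sv X Y \in [set erase X | X in covectors M].
Proof.
case/imsetP=> X' LX ->; case/imsetP=> Y' LY ->.
by rewrite erase_comp; apply: imset_f; apply: covector_comp.
Qed.

Lemma deletion_elim X Y e :
  X \in [set erase X | X in covectors M] ->
  Y \in [set erase X | X in covectors M] -> separates X Y e ->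
  exists2 Z, Z \in [set erase X | X in covectors M] &
    Z e = Zero /\ forall f, ~~ separates X Y f -> Z f = comp_sv X Y f.
Proof.
case/imsetP=> X' LX ->; case/imsetP=> Y' LY ->.
rewrite separates_erase => /andP[eA sXY].
have [Z LZ [Ze ZP]] := covector_elim LX LY sXY.
exists (erase Z); first exact: imset_f.
split; first by rewrite ffunE (negPf eA).
move=> f; rewrite separates_erase erase_comp [LHS]ffunE [RHS]ffunE.
by case: (f \in A) => //= nsXY; apply: ZP.
Qed.

Definition deletion : oriented_matroid U :=
  OrientedMatroid deletion_ground deletion0 deletionN deletion_comp
    deletion_elim.

Definition vanishing : {set {ffun U -> sign}} :=
  [set X in covectors M | [forall e in A, X e == Zero]].

Lemma vanishingP X :
  reflect (X \in covectors M /\ forall e, e \in A -> X e = Zero)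
          (X \in vanishing).
Proof.
rewrite inE; apply: (iffP andP) => -[LX XA]; split=> //.
  by move=> e eA; apply/eqP; move/forall_inP: XA; apply.
by apply/forall_inP=> e eA; apply/eqP/XA.
Qed.

Lemma contraction_ground X :
  X \in vanishing -> support X \subset ground M :\: A.
Proof.
case/vanishingP=> LX XA; apply/subsetP=> e; rewrite !inE => Xe.
rewrite (subsetP (covector_ground LX)) ?inE // andbT.
by apply: contra Xe => /XA ->.
Qed.

Lemma contraction0 : [ffun=> Zero] \in vanishing.
Proof.
by apply/vanishingP; split; [exact: covector0 | move=> e _; rewrite ffunE].
Qed.

Lemma contractionN X : X \in vanishing -> opp_sv X \in vanishing.
Proof.
case/vanishingP=> LX XA; apply/vanishingP; split; first exact: covectorN.
by move=> e /XA Xe; rewrite ffunE Xe.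
Qed.

Lemma contraction_comp X Y :
  X \in vanishing -> Y \in vanishing -> comp_sv X Y \in vanishing.
Proof.
case/vanishingP=> LX XA; case/vanishingP=> LY YA; apply/vanishingP.
split; first exact: covector_comp.
by move=> e eA; rewrite ffunE XA // YA.
Qed.

Lemma contraction_elim X Y e :
  X \in vanishing -> Y \in vanishing -> separates X Y e ->
  exists2 Z, Z \in vanishing &
    Z e = Zero /\ forall f, ~~ separates X Y f -> Z f = comp_sv X Y f.
Proof.
case/vanishingP=> LX XA; case/vanishingP=> LY YA sXY.
have [Z LZ [Ze ZP]] := covector_elim LX LY sXY.
exists Z => //; apply/vanishingP; split=> // f fA.
by rewrite ZP /separates ?ffunE XA // YA.
Qed.

Definition contraction : oriented_matroid U :=
  OrientedMatroid contraction_ground contraction0 contractionN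
    contraction_comp contraction_elim.

End Operations.

Inductive reduces_to (U : finType) (M : oriented_matroid U) :
    oriented_matroid U -> Prop :=
  | reduces_refl : reduces_to M M
  | reduces_reorientation N A :
      reduces_to M N -> reduces_to M (reorientation N A)
  | reduces_deletion N A : reduces_to M N -> reduces_to M (deletion N A)
  | reduces_contraction N A : reduces_to M N -> reduces_to M (contraction N A).

Section Rank.
Variables (U : finType) (M : oriented_matroid U).

Definition zero_set (X : {ffun U -> sign}) : {set U} :=
  [set e in ground M | X e == Zero].

Definition flats : {set {set U}} := [set zero_set X | X in covectors M].

Definition flat_closure (A : {set U}) : {set U} :=
  \bigcap_(F in flats | A \subset F) F.

Definition independent (I : {set U}) : bool :=
  (I \subset ground M) && [forall e in I, e \notin flat_closure (I :\ e)].

Definition rank_of (A : {set U}) : nat :=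
  \max_(I : {set U} | (I \subset A) && independent I) #|I|.

Definition rank : nat := rank_of (ground M).

Definition cocircuit (X : {ffun U -> sign}) : bool :=
  minset (fun S => [exists Y in covectors M,
                      (Y != [ffun=> Zero]) && (S == support Y)]) (support X)
  && (X \in covectors M).

Definition coline (T : {set U}) : bool :=
  (T \in flats) && (rank_of T + 2 == rank).

End Rank.

Definition sign_of (R : realType) (x : R) : sign :=
  (if x == 0 then Zero else if 0 < x then Pos else Neg)%R.

Definition representable (R : realType) (U : finType)
    (M : oriented_matroid U) : Prop :=
  exists v : U -> 'rV[R]_(rank M),
  forall X : {ffun U -> sign},
    X \in covectors M <->
    exists x : 'rV[R]_(rank M),
      X = [ffun e => if e \in ground M
                     then sign_of (\sum_i v e ord0 i * x ord0 i)%R else Zero].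

Section ColineFixation.
Variables (U : finType) (M : oriented_matroid U) (T : {set U}).

Definition supercell : {set {ffun U -> sign}} :=
  [set X in covectors M |
     [forall e in ground M :\: T, X e \in [:: Zero; Pos]]].

Definition face (f : U) : {set {ffun U -> sign}} :=
  [set X in supercell | X f == Zero].

Definition faces : {set {set {ffun U -> sign}}} :=
  [set face f | f in ground M :\: T].

Definition facets : {set {set {ffun U -> sign}}} :=
  [set F | maxset [in faces] F].

Definition generic : Prop :=
  forall f, f \in ground M :\: T ->
  exists2 Y, Y \in covectors M &
    zero_set M Y = f |: T /\ support Y = ground M :\: (f |: T).

Definition proper_fixation : Prop :=
  [/\ generic,
      exists2 Z, Z \in supercell &
        zero_set M Z = T /\ [set e | Z e == Pos] = ground M :\: T
    & forall f, f \in ground M :\: T -> face f \in facets].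

(* E \ T has full rank.  Equivalently, the zero vector is the only covector
   vanishing on E \ T: in the linear case the supercell is a pointed cone, over
   a polytope of dimension r - 1.  Properness does not imply this, and without
   it the Holt-Klee condition in dimension r - 1 can fail even for vector
   configurations.  For instance take T = {(0,0,0,1), (0,1,0,0)} and let E \ T
   consist of the vertices (-2,0,1,0), (-1,-1,1,0), (1,1,1,0), (2,0,1,0) of a
   parallelogram.  Then r = 4 and the fixation is proper, but the shelling
   digraph is a 4-cycle with opposite source and sink, so it has only two
   disjoint paths instead of r - 1 = 3. *)
Definition spanning_complement : Prop :=
  rank_of M (ground M :\: T) = rank M.

Definition shelling_covector (s : seq U) (e : U) : {ffun U -> sign} :=
  [ffun f => if f \in ground M :\: (e |: T)
             then if index f s < index e s then Neg else Pos
             else Zero].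

Definition coline_shelling (s : seq U) : Prop :=
  [/\ uniq s, s =i ground M :\: T
    & forall e, e \in s -> cocircuit M (shelling_covector s e)].

Definition adjacent (e f : U) : bool :=
  maxset (fun A => [exists F in facets, exists G in facets,
                      (F != G) && (A == F :&: G)])
         (face e :&: face f).

Definition shelling_edge (s : seq U) (e f : U) : bool :=
  [&& e \in s, f \in s, index e s < index f s & adjacent e f].

End ColineFixation.

Section HoltKlee.
Variables (U : finType) (V : {set U}) (edge : rel U).

Definition sources : {set U} :=
  [set x in V | [forall y in V, ~~ edge y x]].

Definition sinks : {set U} :=
  [set x in V | [forall y in V, ~~ edge x y]].

(* A directed path from a to b is given by the sequence of its vertices
   after a. *)
Definition holt_klee (d : nat) : Prop :=
  exists a b : U,
  [/\ sources = [set a], sinks = [set b]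
    & exists ps : d.-tuple (seq U),
      [/\ uniq ps,
          forall p, p \in ps ->
            [/\ path edge a p, last a p = b, uniq (a :: p)
              & {subset a :: p <= V}]
        & forall p q x, p \in ps -> q \in ps -> p != q ->
            x \in a :: p -> x \in a :: q -> x = a \/ x = b]].

End HoltKlee.

(* The shelling digraph depends on the choice between a coline shelling and its
   reverse, hence the quantification over all shellings; the first conjunct
   excludes vacuity. *)
Definition fixation_HK_star (U : finType) (M : oriented_matroid U)
    (T : {set U}) : Prop :=
  (exists s, coline_shelling M T s) /\
  forall s, coline_shelling M T s ->
    holt_klee (ground M :\: T) (shelling_edge M T s) (rank M - 1).

Definition HK_star (U : finType) (M : oriented_matroid U) : Prop :=
  forall N, reduces_to M N ->
  forall T, coline N T -> proper_fixation N T -> spanning_complement N T ->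
    fixation_HK_star N T.

(* Main.v *)
Require Import Defs.
From mathcomp Require Import all_boot all_order all_algebra ring lra.
From mathcomp Require Import boolp reals.

(** A minor of a realized oriented matroid is realized by vectors [v e], so it
suffices to treat a proper fixation [(N, T)] of a realized oriented matroid of
rank [r]. Since [T] is a coline, the functionals that vanish on [T] form a plane,
up to those that vanish everywhere. This plane contains a functional [z] that is
positive on the complement [V] of [T]; let [u] complete it to a basis. After
rescaling the vectors of [V] so that [z = 1], they span an affine space of
dimension [r - 1], and the supercell is the cone of the functionals that are
nonnegative on their convex hull [Q]. The following dictionary holds:
- every vector of [V] is a vertex of [Q] ([vertex_exposed]); properness says that
  all faces of the supercell are facets, and genericity that [u] is injective on
  [V];
- the endpoints of an edge of [Q] are adjacent facets ([edge_adjacent]);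
- the coline shellings are the enumerations of [V] along [u] or along [- u]
  ([exists_coline_shelling], [coline_shelling_order]), because the cocircuits
  that vanish on [T] are given by the functionals [u - u(e) z] and their
  opposites.

It remains to prove the Holt-Klee theorem ([polytope_holt_klee]): in a polytope
of dimension [d], whose edges are directed by a generic functional [u], there are
[d] independent monotone paths from the lowest vertex [a] to the highest vertex
[b]. By Menger's theorem ([menger]), it is enough that fewer than [d] other
vertices never separate [a] from [b]. Given such a set [S], choose a hyperplane
[g = 0] through [S] and [a] that does not contain [Q]. Up to the sign of [g], the
vertex [b] is on its nonnegative side, and some vertex is on its positive side.
Project [Q] to the plane by [(u, g)]. The upper boundary of the image goes from
the image of [a] to the image of [b] and lies strictly above the line [g = 0] in
between ([upper_gt0]). It lifts to a monotone path of [Q], because each of its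
segments is the image of a face, in which the simplex method finds an improving
edge ([improving_edge], [upper_step]). This path avoids [S]. If [a] and [b] are
adjacent, then their edge is one of the [d] paths; [S] has one element fewer, the
hyperplane is also chosen to contain [b], and then the upper boundary does not
start with this edge. *)

Set Implicit Arguments.
Unset Strict Implicit.
Unset Printing Implicit Defensive.

Import Order.TTheory GRing.Theory Num.Theory.

(** * Disjoint paths *)

Section Menger.
Variable U : finType.
Implicit Types (e : rel U) (A B C S X : {set U}) (P : U -> seq U).

(** A family of pairwise disjoint paths from [A] to [B]: [X] is the set of
    their first vertices, and [x :: P x] is the path that starts at [x]. *)
Definition linkage e A B X P : Prop :=
  [/\ X \subset A,
      forall x, x \in X -> path e x (P x) /\ last x (P x) \in B
    & forall x y t, x \in X -> y \in X ->
        t \in x :: P x -> t \in y :: P y -> x = y].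

(** Some path from [A] to [B] avoids [S], that is, [S] does not separate [A]
    from [B]. *)
Definition linked_off e A B S : Prop :=
  exists x p, [/\ x \in A, path e x p, last x p \in B
                & forall t, t \in x :: p -> t \notin S].

Definition remove_edge e a b : rel U :=
  fun x y => e x y && ~~ ((x == a) && (y == b)).
Arguments remove_edge e a b x y /.

Lemma remove_edge_sub e a b x p : path (remove_edge e a b) x p -> path e x p.
Proof. by apply: sub_path => s t /andP[]. Qed.

Lemma remove_edge_path e a b c x p :
    c = a \/ c = b -> path e x p -> c \notin x :: p ->
  path (remove_edge e a b) x p.
Proof.
move=> cab; elim: p x => //= y p IHp x /andP[exy yp] cNp.
rewrite /= exy IHp ?andbT //=; last by move: cNp; rewrite inE negb_or => /andP[].
apply: contra cNp => /andP[/eqP-> /eqP->].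
by case: cab => ->; rewrite !inE eqxx ?orbT.
Qed.

Lemma path_first_hit e a b C x p :
    a \in C -> path e x p -> has [in C] (x :: p) ->
  exists q, [/\ path (remove_edge e a b) x q, last x q \in C
              & {subset x :: q <= x :: p}].
Proof.
move=> aC; elim: p x => [|y p IHp] x /=.
  by rewrite orbF => _ xC; exists [::]; split.
case/andP=> exy yp; case: (boolP (x \in C)) => [xC _|xC hC].
  exists [::]; split=> //= t; rewrite !inE => /eqP->; by rewrite eqxx.
have [q [yq lq sq]] := IHp y yp hC.
exists (y :: q); split=> //=.
  by rewrite exy yq andbT /=; apply: contra xC => /andP[/eqP->].
move=> t; rewrite !inE => /orP[->//|tq].
by have:= sq t; rewrite !inE => -> //; rewrite orbT.
Qed.

Lemma path_last_hit e a b C x p :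
    b \in C -> path e x p -> has [in C] (x :: p) ->
  exists y q, [/\ y \in C, path (remove_edge e a b) y q, last y q = last x p
                & {subset y :: q <= x :: p}].
Proof.
move=> bC; elim: p x => [|y p IHp] x /=.
  by rewrite orbF => _ xC; exists x, [::]; split.
case/andP=> exy yp hC; case: (boolP (has [in C] (y :: p))) => [|nC].
  case/(IHp y yp)=> y' [q [yC yq lq sq]]; exists y', q; split=> // t /sq.
  by rewrite !inE => ->; rewrite orbT.
exists x, (y :: p); split=> //.
  by move: hC nC => /= /orP[//|->].
have bN : b \notin y :: p.
  by apply: contra nC => bp; apply/hasP; exists b.
rewrite /= exy /= (@remove_edge_path _ _ _ b) ?andbT //; last by right.
by apply: contra bN => /andP[_ /eqP->]; rewrite mem_head.
Qed.

Lemma linkage_shorten e A B X P :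
    linkage e A B X P ->
  exists P', linkage e A B X P' /\ forall x, x \in X -> uniq (x :: P' x).
Proof.
case=> sXA XP dP.
have HP x : x \in X -> exists q,
    [/\ path e x q, last x q \in B, uniq (x :: q) & {subset q <= P x}].
  case/XP; case/shortenP=> q eq uq sq lq; exists q; split=> //.
have sub x q : {subset q <= P x} -> {subset x :: q <= x :: P x}.
  by move=> sq t; rewrite !inE => /orP[->//|/sq->]; rewrite orbT.
have /choice[f fP] x : exists q, x \in X ->
    [/\ path e x q, last x q \in B, uniq (x :: q) & {subset q <= P x}].
  by case: (boolP (x \in X)) => [/HP[q]|_]; [exists q | exists [::]].
exists f; split=> [|x /fP[] //]; split=> // [x /fP[] //|x y t xX yX tx ty].
have [_ _ _ sx] := fP x xX; have [_ _ _ sy] := fP y yX.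
by apply: (dP x y t) => //; apply: sub; eassumption.
Qed.

(** The vertex version of Menger's theorem for digraphs, by Göring's induction
    on the number of edges. If deleting the edge from [a] to [b] creates a
    separator [S] of size [k - 1], then [a |: S] and [b |: S] have size [k], and
    the [k] disjoint paths from [A] to [a |: S] and from [b |: S] to [B] can be
    glued, because they only meet in [S]. *)
Theorem menger e A B k :
    (forall S, #|S| < k -> linked_off e A B S) ->
  exists X P, linkage e A B X P /\ #|X| = k.
Proof.
have [m] := ubnP #|[set st : U * U | e st.1 st.2]|.
elim: m e A B => // m IHm e A B; rewrite ltnS => le_em sepAB.
case: (pickP [pred st : U * U | e st.1 st.2]) => /= [[a b] /= eab|e0]; last first.
  have kAB : k <= #|A :&: B|.
    rewrite leqNgt; apply/negP => /sepAB[x [[|y p] [xA xp lB xS]]].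
      by have:= xS x (mem_head _ _); rewrite inE xA /= in lB *; rewrite lB.
    by have:= e0 (x, y); move: xp => /= /andP[->].
  have [s [us <- sAB]] := card_geqP kAB.
  exists [set x in s], (fun=> [::]); split; last first.
    by rewrite cardsE; apply/card_uniqP.
  split=> [|x|x y t _ _]; rewrite ?inE.
  - by apply/subsetP => x; rewrite inE => /sAB /setIP[].
  - by move/sAB/setIP => [].
  - by move=> /eqP-> /eqP.
set e' := remove_edge e a b.
have lt_e'm : #|[set st : U * U | e' st.1 st.2]| < m.
  apply: leq_trans le_em; apply: proper_card; apply/properP; split.
    by apply/subsetP => st; rewrite !inE => /andP[].
  by exists (a, b); rewrite inE // /e' /= !eqxx andbF.
have [sep'|] := EM (forall S, #|S| < k -> linked_off e' A B S).
  have [X [P [[sXA XP dP] cX]]] := IHm e' A B lt_e'm sep'.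
  exists X, P; split=> //; split=> // x /XP[xP lB].
  by split=> //; apply: remove_edge_sub xP.
move/existsNP=> [S /not_implyP[ltSk NS]].
have card_sep c : c = a \/ c = b -> #|c |: S| = k /\ c \notin S.
  move=> cab; have ge_k : k <= #|c |: S|.
    rewrite leqNgt; apply/negP => /sepAB[x [p [xA xp lB xS]]]; apply: NS.
    exists x, p; split=> //.
      apply: (remove_edge_path cab) => //.
      by apply/negP => /xS; rewrite !inE eqxx.
    by move=> t /xS; rewrite !inE negb_or => /andP[].
  move: ge_k; rewrite cardsU1; case: (boolP (c \in S)) => cS /=.
    by rewrite leqNgt ltSk.
  by rewrite add1n => ge_k; split=> //; apply/eqP; rewrite eqn_leq ltSk.
have [ca aS] := card_sep a (or_introl erefl).
have [cb bS] := card_sep b (or_intror erefl).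
have hitS c x p : c = a \/ c = b -> x \in A -> path e x p -> last x p \in B ->
    has [in c |: S] (x :: p).
  move=> cab xA xp lB; apply/negPn/negP => /hasPn hN; apply: NS.
  exists x, p; split=> //.
    apply: (remove_edge_path cab) => //.
    by apply/negP => /hN; rewrite /= !inE eqxx.
  by move=> t /hN; rewrite /= !inE negb_or => /andP[].
have [X [P0 [L0 cX]]] : exists X P, linkage e' A (a |: S) X P /\ #|X| = k.
  apply: IHm => // S' /sepAB[x [p [xA xp lB xS]]].
  have [q [xq lq sq]] := @path_first_hit e a b (a |: S) x p (setU11 _ _) xp
    (hitS a x p (or_introl erefl) xA xp lB).
  by exists x, q; split=> // t /sq/xS.
have [Y [Q0 [L1 cY]]] : exists Y Q, linkage e' (b |: S) B Y Q /\ #|Y| = k.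
  apply: IHm => // S' /sepAB[x [p [xA xp lB xS]]].
  have [y [q [yC yq lq sq]]] := @path_last_hit e a b (b |: S) x p (setU11 _ _) xp
    (hitS b x p (or_intror erefl) xA xp lB).
  by exists y, q; split=> // [|t /sq/xS //]; rewrite lq.
have [P [[sXA XP dP] uP]] := linkage_shorten L0.
have [Q [[sYb YQ dQ] uQ]] := linkage_shorten L1.
have defY : Y = b |: S by apply/eqP; rewrite eqEcard sYb cb cY leqnn.
have lastX x x' : x \in X -> x' \in X -> last x (P x) = last x' (P x') -> x = x'.
  move=> xX x'X lE; apply: (dP x x' (last x (P x))) => //; first exact: mem_last.
  by rewrite lE mem_last.
have endP x t : x \in X -> t \in x :: P x -> t \in a |: S -> t = last x (P x).
  move=> xX tx taS.
  have imX : [set last y (P y) | y in X] = a |: S.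
    apply/eqP; rewrite eqEcard ca card_in_imset ?cX ?leqnn ?andbT //.
    by apply/subsetP => _ /imsetP[y yX ->]; case: (XP y yX).
  move: taS; rewrite -imX => /imsetP[y yX tE].
  by rewrite (dP x y t) // tE mem_last.
have startQ y t : y \in Y -> t \in y :: Q y -> t \in b |: S -> t = y.
  by move=> yY ty; rewrite -defY => tY; apply: (dQ t y t) => //; apply: mem_head.
have meet x y t : x \in X -> y \in Y -> t \in x :: P x -> t \in y :: Q y ->
    [/\ t \in S, t = last x (P x) & t = y].
  move=> xX yY tx ty; suff tS : t \in S.
    by split=> //; [apply: endP | apply: startQ] => //; rewrite inE tS orbT.
  apply/negPn/negP => tS; apply: NS.
  have [xP _] := XP x xX; have [yQ lB] := YQ y yY.
  have := endP x ^~ xX; have := startQ y ^~ yY.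
  move: xP lB yQ (uP x xX) (uQ y yY).
  case/splitPl: tx => p1 p2 lp1; case/splitPl: ty => q1 q2 lq1.
  rewrite !cat_path !last_cat lp1 lq1 -!cat_cons !cat_uniq.
  move=> /andP[xp1 _] lB /andP[_ tq2] /and3P[_ nxp _] /and3P[_ nyq _] sQ eP.
  exists x, (p1 ++ q2); split.
  - exact: (subsetP sXA).
  - by rewrite cat_path xp1 lp1.
  - by rewrite last_cat lp1.
  move=> r; rewrite -cat_cons mem_cat => /orP[rp1|rq2]; apply/negP => rS.
    have := eP r; rewrite mem_cat rp1 inE rS orbT.
    move=> /(_ isT isT); case: p2 {eP} nxp => [|s p2] nxp /= rE.
      by rewrite -rE rS in tS.
    by case/negP: nxp; apply/hasP; exists r => //; rewrite rE mem_last.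
  have := sQ r; rewrite mem_cat rq2 orbT inE rS orbT => /(_ isT isT) rE.
  by case/negP: nyq; apply/hasP; exists r => //; rewrite rE mem_head.
(* The continuation of a path that ends at [l]: it has to cross the deleted
   edge when [l] is [a]. *)
pose glue l := if l == a then b :: Q b else Q l.
pose start l := if l == a then b else l.
have startY x : x \in X -> start (last x (P x)) \in Y.
  move=> xX; have [_] := XP x xX; rewrite defY /start !inE.
  by case: eqP => [_|_ /= ->]; rewrite ?eqxx ?orbT.
have glueE x t : t \in x :: P x ++ glue (last x (P x)) ->
    t \in x :: P x \/ t \in start (last x (P x)) :: Q (start (last x (P x))).
  rewrite -cat_cons mem_cat /glue /start => /orP[|]; first by left.
  by case: eqP => _ tQ; right; rewrite // inE tQ orbT.
have eP x p : path e' x p -> path e x p by apply: remove_edge_sub.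
exists X, (fun x => P x ++ glue (last x (P x))); split=> //; split=> //.
  move=> x xX; have [xP lS] := XP x xX; rewrite cat_path last_cat eP //=.
  have := startY x xX; rewrite /glue /start; case: eqP => [->|_] /YQ[lQ lB] /=.
    by rewrite eab eP.
  by rewrite eP.
have cross x y t : x \in X -> y \in X -> t \in x :: P x ->
    t \in start (last y (P y)) :: Q (start (last y (P y))) -> x = y.
  move=> xX yX tx ty; have [tS tE tE'] := meet x _ t xX (startY y yX) tx ty.
  apply: lastX => //; rewrite -tE tE' /start; move: tS; rewrite tE' /start.
  by case: eqP => // _; rewrite (negPf bS).
move=> x y t xX yX /glueE[] tx /glueE[] ty.
- exact: (dP x y t).
- exact: cross ty.
- by apply/esym; apply: cross tx.
- apply: lastX => //; have := dQ _ _ t (startY x xX) (startY y yX) tx ty.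
  have [_] := XP x xX; have [_] := XP y yX; rewrite /start !inE.
  move: (last x (P x)) (last y (P y)) => l l'.
  case: (eqVneq l a) => [->|_]; case: (eqVneq l' a) => [->|_] //=.
    by move=> l'S _ bl'; rewrite bl' l'S in bS.
  by move=> _ lS lb; rewrite -lb lS in bS.
Qed.

End Menger.

Local Open Scope ring_scope.

(** * Faces of a polytope *)

(** The value at the vector [v e] of the linear functional with coordinates
    [x]. *)
Definition value (R : pzRingType) (U : Type) n (v : U -> 'rV[R]_n) (x : 'cV[R]_n)
    (e : U) : R :=
  (v e *m x) 0 0.

Section Evaluation.
Variables (R : comPzRingType) (U : Type) (n : nat) (v : U -> 'rV[R]_n).

Lemma evD x y e : value v (x + y) e = value v x e + value v y e.
Proof. by rewrite /value mulmxDr mxE. Qed.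

Lemma evN x e : value v (- x) e = - value v x e.
Proof. by rewrite /value mulmxN mxE. Qed.

Lemma evZ c x e : value v (c *: x) e = c * value v x e.
Proof. by rewrite /value -scalemxAr mxE. Qed.

Definition evE := (evD, evN, evZ).

End Evaluation.

Section Polytope.
Variables (R : realFieldType) (U : finType) (n : nat) (v : U -> 'rV[R]_n).
Variable V : {set U}.
Local Notation ev := (value v).

(** The cone of the functionals that are nonnegative on [V]. *)
Definition nonneg x : Prop := forall e, e \in V -> 0 <= ev x e.

(** The zeros in [V] of a functional; they form a face of the configuration when
    the functional is nonnegative on [V]. *)
Definition zeros x : {set U} := [set e in V | ev x e == 0].

Lemma in_zeros x e : (e \in zeros x) = (e \in V) && (ev x e == 0).
Proof. by rewrite inE. Qed.

(** A functional that is nonnegative on a face cuts out a subface. *)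
Lemma subface x g :
    nonneg x -> (forall e, e \in zeros x -> 0 <= ev g e) ->
  exists2 y, nonneg y & zeros y = zeros x :&: zeros g.
Proof.
move=> x0 g0; pose K := 1 + \sum_(e in V) `|ev g e| / ev x e.
have Kpos e : e \in V -> 0 < ev x e -> 0 < K * ev x e + ev g e.
  move=> eV xe; have Kle : 1 + `|ev g e| / ev x e <= K.
    rewrite lerD2l (bigD1 e) //= lerDl; apply: sumr_ge0 => f /andP[fV _].
    by rewrite divr_ge0 ?normr_ge0 ?x0.
  have : (1 + `|ev g e| / ev x e) * ev x e <= K * ev x e by rewrite ler_pM2r.
  rewrite mulrDl mul1r divfK ?gt_eqF // => {}Kle.
  by have := ler_norm (- ev g e); rewrite normrN; lra.
exists (K *: x + g) => [e eV|].
  rewrite !evE; have := x0 e eV; rewrite le_eqVlt => /orP[/eqP xe0|xe].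
    by rewrite -xe0 mulr0 add0r g0 // inE eV -xe0 eqxx.
  exact/ltW/Kpos.
apply/setP => e; rewrite !inE; case: (boolP (e \in V)) => //= eV.
have := x0 e eV; rewrite le_eqVlt !evE => /orP[/eqP xe0|xe].
  by rewrite -xe0 mulr0 add0r eqxx.
by rewrite (gt_eqF xe) (gt_eqF (Kpos e eV xe)).
Qed.

(** The point [v a] is a vertex: some face consists of [a] alone. *)
Definition exposed a := exists2 x, nonneg x & zeros x = [set a].

Lemma exposing a x : nonneg x -> zeros x = [set a] ->
  ev x a = 0 /\ forall e, e \in V -> e != a -> 0 < ev x e.
Proof.
move=> x0 Zx; split=> [|e eV nea].
  by have := set11 a; rewrite -Zx in_zeros => /andP[_ /eqP].
rewrite lt_def x0 // andbT; apply: contra nea => xe.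
by rewrite -in_set1 -Zx in_zeros eV.
Qed.

(** Rotating a functional [g] that vanishes at a vertex [a] of a face [F] around
    [a], until it supports [F] along a face that is larger than [a]. *)
Lemma rotate (F : {set U}) a b xa g :
    nonneg xa -> zeros xa = [set a] -> F \subset V -> a \in F -> b \in F ->
    b != a -> ev g a = 0 ->
  exists c f, [/\ f \in F, f != a, ev g f = c * ev xa f
                & forall e, e \in F -> ev g e <= c * ev xa e].
Proof.
move=> xa0 Za /subsetP FV aF bF nba ga.
have [xaa xaV] := exposing xa0 Za.
have xa_gt e : e \in F -> e != a -> 0 < ev xa e by move/FV; apply: xaV.
have bFa : (b \in F) && (b != a) by rewrite bF.
case: (@arg_maxP _ _ _ b [pred e | (e \in F) && (e != a)]
          (fun e => ev g e / ev xa e) bFa) => f /= /andP[fF nfa] fmax.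
exists (ev g f / ev xa f), f; split=> // [|e eF].
  by rewrite divfK // gt_eqF ?xa_gt.
have [->|nea] := eqVneq e a; first by rewrite ga xaa mulr0.
by rewrite -ler_pdivrMr ?xa_gt //; apply: fmax; rewrite eF.
Qed.

Variable z : 'cV[R]_n.
Hypothesis z1 : forall e, e \in V -> ev z e = 1.
Hypothesis vertices : forall a, a \in V -> exposed a.

(** The simplex method: in a face, a vertex that does not maximize [u] is joined
    to a better vertex by an edge. A smallest face containing the vertex [a] and
    a better vertex is an edge, because all the functionals that vanish at [a]
    are proportional on it: otherwise one could be rotated to cut out a smaller
    face. *)
Lemma improving_edge p u a b :
    nonneg p -> a \in zeros p -> b \in zeros p -> ev u a < ev u b ->
  exists y, [/\ y \in zeros p, ev u a < ev u y
              & exists2 q, nonneg q & zeros q = [set a; y]].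
Proof.
have [m] := ubnP #|zeros p|; elim: m p b => // m IHm p b; rewrite ltnS.
move=> le_pm p0 ap bp uab; set F := zeros p in le_pm ap bp *.
have FV : F \subset V by apply/subsetP => e; rewrite inE => /andP[].
have aV : a \in V by rewrite (subsetP FV).
have nba : b != a by apply: contraTneq uab => ->; rewrite ltxx.
have [xa xa0 Za] := vertices aV.
have [xaa xaV] := exposing xa0 Za.
have xa_gt e : e \in F -> e != a -> 0 < ev xa e.
  by move/(subsetP FV); apply: xaV.
(* Rotate [g] around [a]: either this cuts out a proper subface with a vertex [f]
   other than [a], where the ratio of [g] to [xa] is at least its value at [b],
   or [g] is proportional to [xa] on the whole face. *)
have cut g : ev g a = 0 ->
    (exists p' f, [/\ nonneg p', zeros p' \proper F, a \in zeros p',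
                  f \in zeros p' & f != a /\
                  exists c, ev g f = c * ev xa f /\ ev g b <= c * ev xa b])
    \/ (exists c, forall e, e \in F -> ev g e = c * ev xa e).
  move=> ga; have [c [f [fF nfa gf gmax]]] := rotate xa0 Za FV ap bp nba ga.
  pose h := c *: xa - g.
  have hE e : ev h e = c * ev xa e - ev g e by rewrite !evE.
  have h0 e : e \in F -> 0 <= ev h e by move/gmax; rewrite hE subr_ge0.
  have [/subsetP sFh|nsFh] := boolP (F \subset zeros h).
    right; exists c => e /sFh; rewrite inE hE subr_eq0 => /andP[_ /eqP->] //.
  have [p' p'0 Zp'] := subface p0 h0.
  left; exists p', f; split=> //; rewrite ?Zp' -/F.
  - by rewrite properE subsetIl subsetI negb_and nsFh orbT.
  - by rewrite inE ap inE aV hE ga xaa mulr0 subr0 eqxx.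
  - by rewrite inE fF inE (subsetP FV) // hE gf subrr eqxx.
  - by split=> //; exists c; rewrite gf gmax.
have uE e : e \in V -> ev (u - ev u a *: z) e = ev u e - ev u a.
  by move=> eV; rewrite !evE z1 // mulr1.
have [|[p' [f [p'0 Zp' ap' fp' [nfa [c [ufE ub]]]]]]|[c uF]] :=
    cut (u - ev u a *: z); first by rewrite uE // subrr.
  have bV := subsetP FV _ bp; have fF := subsetP (proper_sub Zp') _ fp'.
  rewrite !uE // in ufE ub; last exact: (subsetP FV).
  have c0 : 0 < c.
    by rewrite -(pmulr_lgt0 _ (xa_gt b bp nba)); lra.
  have uaf : ev u a < ev u f by rewrite -subr_gt0 ufE mulr_gt0 // xa_gt.
  have ltm := leq_trans (proper_card Zp') le_pm.
  have [y [yp' uay qP]] := IHm p' f ltm p'0 ap' fp' uaf.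
  by exists y; split=> //; apply: (subsetP (proper_sub Zp')).
have c0 : 0 < c.
  rewrite -(pmulr_lgt0 _ (xa_gt b bp nba)) -uF // uE ?(subsetP FV) //.
  by rewrite subr_gt0.
have u_gt e : e \in F -> e != a -> ev u a < ev u e.
  move=> eF nea; rewrite -subr_gt0 -uE ?(subsetP FV) // uF // mulr_gt0 //.
  exact: xa_gt.
(* Now every vertex of the face other than [a] is better than [a], so that any
   subface with such a vertex will do. *)
have [[p' [f [p'0 Zp' ap' fp' nfa]]]|prop] :=
    EM (exists p' f, [/\ nonneg p', zeros p' \proper F, a \in zeros p',
                  f \in zeros p' & f != a]).
  have uaf := u_gt f (subsetP (proper_sub Zp') _ fp') nfa.
  have ltm := leq_trans (proper_card Zp') le_pm.
  have [y [yp' uay qP]] := IHm p' f ltm p'0 ap' fp' uaf.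
  by exists y; split=> //; apply: (subsetP (proper_sub Zp')).
(* The functional that exposes [y] is constant minus a positive multiple of
   [xa]: hence [xa] is maximal at [y] only. *)
have xa_max y e : y \in F -> y != a -> e \in F -> e != y -> ev xa e < ev xa y.
  move=> yF nya eF ney; have yV := subsetP FV _ yF.
  have [xy xy0 Zy] := vertices yV.
  have [xyy xyV] := exposing xy0 Zy.
  have xy_gt f : f \in F -> f != y -> 0 < ev xy f.
    by move/(subsetP FV); apply: xyV.
  have gE f : f \in V -> ev (ev xy a *: z - xy) f = ev xy a - ev xy f.
    by move=> fV; rewrite !evE z1 // mulr1.
  have [|[p' [f [p'0 Zp' ap' fp' [nfa _]]]]|[d gF]] := cut (ev xy a *: z - xy).
  - by rewrite gE // subrr.
  - by case: prop; exists p', f.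
  have := gF y yF; have := gF e eF; rewrite !gE ?(subsetP FV) //.
  rewrite xyy subr0 => eE yE.
  have d0 : 0 < d.
    by rewrite -(pmulr_lgt0 _ (xa_gt y yF nya)) -yE xy_gt // eq_sym.
  by rewrite -(ltr_pM2l d0) -eE -yE gtrBl xy_gt.
exists b; split=> //; exists p => //; apply/setP => e; rewrite in_set2.
apply/idP/idP => [eF|/orP[]/eqP-> //]; apply/negPn.
rewrite negb_or; apply/negP => /andP[nea neb].
have := xa_max b e bp nba eF neb.
by rewrite ltNge ltW // xa_max // eq_sym.
Qed.

End Polytope.

(** * The Holt-Klee theorem *)

Section HoltKlee.
Variables (R : realFieldType) (U : finType) (n : nat) (v : U -> 'rV[R]_n).
Variables (V : {set U}) (z u : 'cV[R]_n) (E : rel U).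
Local Notation ev := (value v).

Hypothesis z1 : forall e, e \in V -> ev z e = 1.
Hypothesis vertices : forall a, a \in V -> exposed v V a.
Hypothesis u_inj : {in V &, injective (ev u)}.
Hypothesis E_lt : forall x y, E x y -> [/\ x \in V, y \in V & ev u x < ev u y].
Hypothesis E_edge : forall x y q, x \in V -> y \in V ->
  nonneg v V q -> zeros v V q = [set x; y] -> ev u x < ev u y -> E x y.

Let zeros0 e : e \in V -> e \in zeros v V 0.
Proof. by move=> eV; rewrite inE eV /value mulmx0 mxE eqxx. Qed.

Let nonneg0 : nonneg v V 0.
Proof. by move=> e _; rewrite /value mulmx0 mxE. Qed.

Lemma lt_has_out x b : x \in V -> b \in V -> ev u x < ev u b ->
  exists2 y, y \in V & E x y.
Proof.
move=> xV bV uxb.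
have [y [+ uxy [q q0 Zq]]] :=
  improving_edge z1 vertices nonneg0 (zeros0 xV) (zeros0 bV) uxb.
by rewrite inE => /andP[yV _]; exists y => //; apply: E_edge Zq uxy.
Qed.

Lemma gt_has_in x b : x \in V -> b \in V -> ev u b < ev u x ->
  exists2 y, y \in V & E y x.
Proof.
move=> xV bV ubx; have uxb : ev (- u) x < ev (- u) b by rewrite !evE ltrN2.
have [y [+ uxy [q q0 Zq]]] :=
  improving_edge z1 vertices nonneg0 (zeros0 xV) (zeros0 bV) uxb.
rewrite inE => /andP[yV _]; exists y => //; rewrite !evE ltrN2 in uxy.
by apply: E_edge yV xV q0 _ uxy; rewrite Zq setUC.
Qed.

Section UpperHull.
Variable g : 'cV[R]_n.

(** The image of [x] under the projection [(u, g)] to the plane lies on the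
    upper boundary of the image of the polytope: the slopes on its right are at
    most the slopes on its left. *)
Definition upper x : Prop := forall e y, e \in V -> y \in V ->
  ev u e < ev u x -> ev u x < ev u y ->
  (ev g y - ev g x) * (ev u x - ev u e) <= (ev g x - ev g e) * (ev u y - ev u x).

(** The slope [c] of the first segment of the upper boundary on the right of [x]
    defines a face of the polytope, which contains an edge from [x]. *)
Lemma upper_step x b : x \in V -> b \in V -> ev u x < ev u b -> upper x ->
  exists y c, [/\ E x y, upper y, ev g y - ev g x = c * (ev u y - ev u x)
    & forall e, e \in V -> ev g e - ev g x <= c * (ev u e - ev u x)].
Proof.
move=> xV bV uxb xup.
have bP : (b \in V) && (ev u x < ev u b) by rewrite bV.
case: (@arg_maxP _ _ _ b [pred e | (e \in V) && (ev u x < ev u e)]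
  (fun e => (ev g e - ev g x) / (ev u e - ev u x)) bP) => y0 /andP[y0V uxy0] ymax.
set c := _ / _ in ymax.
have cE : ev g y0 - ev g x = c * (ev u y0 - ev u x).
  by rewrite divfK // subr_eq0 gt_eqF.
have le_c e : e \in V -> ev g e - ev g x <= c * (ev u e - ev u x).
  move=> eV; case: (ltgtP (ev u e) (ev u x)) => [uex|uxe|/u_inj->//].
  - have := xup e y0 eV y0V uex uxy0; rewrite cE mulrAC ler_pM2r ?subr_gt0 //.
    lra.
  - rewrite -ler_pdivrMr ?subr_gt0 //; apply: (ymax e).
    by rewrite /= eV.
  - by rewrite !subrr mulr0.
pose p := c *: u - g + (ev g x - c * ev u x) *: z.
have pE e : e \in V -> ev p e = c * (ev u e - ev u x) - (ev g e - ev g x).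
  by move=> eV; rewrite !evE z1 //; ring.
have p0 : nonneg v V p by move=> e eV; rewrite pE // subr_ge0 le_c.
have px : x \in zeros v V p by rewrite inE xV pE // !subrr mulr0 subr0 eqxx.
have py0 : y0 \in zeros v V p by rewrite inE y0V pE // cE subrr eqxx.
have [y [+ uxy [q q0 Zq]]] := improving_edge z1 vertices p0 px py0 uxy0.
rewrite inE => /andP[yV]; rewrite pE // subr_eq0 => /eqP/esym yE.
exists y, c; split=> //; first exact: E_edge Zq uxy.
move=> e f eV fV uey uyf; have := le_c e eV; have := le_c f fV => lef lee.
have -> : ev g f - ev g y = (ev g f - ev g x) - c * (ev u y - ev u x).
  by rewrite -yE; ring.
have -> : ev g y - ev g e = c * (ev u y - ev u x) - (ev g e - ev g x).
  by rewrite -yE; ring.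
apply: (@le_trans _ _ (c * (ev u f - ev u y) * (ev u y - ev u e))).
  by rewrite ler_pM2r ?subr_gt0 //; lra.
by rewrite mulrAC ler_pM2r ?subr_gt0 //; lra.
Qed.

Variables a b c0 : U.
Hypotheses (aV : a \in V) (bV : b \in V) (c0V : c0 \in V).
Hypotheses (ga : ev g a = 0) (gb : 0 <= ev g b) (gc0 : 0 < ev g c0).

Lemma upper_gt0 x : x \in V -> ev u a < ev u x -> ev u x < ev u b -> upper x ->
  0 < ev g x.
Proof.
move=> xV uax uxb xup; have := xup a b aV bV uax uxb; rewrite ga subr0 => leab.
rewrite ltNge; apply/negP => gx0.
have [gx gb0] : ev g x = 0 /\ ev g b = 0.
  have : ev g b - ev g x <= 0.
    have D_gt0 : 0 < ev u x - ev u a by rewrite subr_gt0.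
    rewrite -(pmulr_lle0 _ D_gt0); apply: le_trans leab _.
    by rewrite mulr_le0_ge0 // subr_ge0 ltW.
  by move: gb; lra.
case: (ltgtP (ev u c0) (ev u x)) => [ucx|uxc|/u_inj cE].
- by have := xup c0 b c0V bV ucx uxb; rewrite gx gb0; move: gc0; nra.
- by have := xup a c0 aV c0V uax uxc; rewrite gx ga; move: gc0; nra.
- by move: gc0; rewrite cE // gx ltxx.
Qed.

Hypothesis min_a : forall e, e \in V -> ev u a <= ev u e.
Hypothesis max_b : forall e, e \in V -> ev u e <= ev u b.

(** The edges between vertices other than [a] and [b]. *)
Definition inner_edge : rel U :=
  fun x y => [&& E x y, x \in V :\: [set a; b] & y \in V :\: [set a; b]].

Lemma inner_path x p : path inner_edge x p -> x \in V :\: [set a; b] ->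
  {subset x :: p <= V :\: [set a; b]}.
Proof.
elim: p x => [|y p IHp] x /=; first by move=> _ xI t; rewrite inE => /eqP->.
move=> /andP[/and3P[_ _ yI] /IHp sI] xI t; rewrite inE => /orP[/eqP->//|].
exact: sI.
Qed.

Lemma inner_between x : x \in V :\: [set a; b] ->
  [/\ x \in V, ev u a < ev u x & ev u x < ev u b].
Proof.
rewrite !inE negb_or => /andP[/andP[nxa nxb] xV].
split=> //; rewrite lt_neqAle ?min_a ?max_b // andbT.
  by apply: contra nxa => /eqP/u_inj-> //; rewrite eqxx.
by apply: contra nxb => /eqP/u_inj-> //; rewrite eqxx.
Qed.

Lemma upper_path x : x \in V :\: [set a; b] -> upper x ->
  exists p, [/\ path inner_edge x p, last x p \in V :\: [set a; b],
    E (last x p) b & forall t, t \in x :: p -> 0 < ev g t].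
Proof.
have [m] := ubnP #|[set e in V | ev u x < ev u e]|.
elim: m x => // m IHm x; rewrite ltnS => le_m xI xup.
have [xV uax uxb] := inner_between xI.
have gx : 0 < ev g x by apply: upper_gt0.
have [y [c [Exy yup _ _]]] := upper_step xV bV uxb xup.
have [_ yV uxy] := E_lt Exy.
have [yb|nyb] := eqVneq y b.
  exists [::]; split=> //=; first by rewrite -yb.
  by move=> t; rewrite inE => /eqP->.
have yI : y \in V :\: [set a; b].
  rewrite !inE negb_or nyb yV !andbT; apply: contraTneq uxy => ->.
  by rewrite -leNgt min_a.
have [||//|p [yp lI lb gp]] := IHm y.
- apply: leq_trans le_m; apply: proper_card; apply/properP; split.
    by apply/subsetP => e; rewrite !inE => /andP[-> /(lt_trans uxy)].
  by exists y; rewrite !inE yV ?ltxx.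
- by [].
exists (y :: p); split=> //=; first by rewrite /inner_edge Exy xI yI.
by move=> t; rewrite inE => /orP[/eqP->//|/gp].
Qed.

(** The second hypothesis prevents the upper boundary from being the single
    edge from [a] to [b]: it would lie on the line [g = 0], below the image of [c0]. *)
Lemma upper_path_from : ev u a < ev u b -> (E a b -> ev g b = 0) ->
  exists x p, [/\ x \in V :\: [set a; b], E a x, path inner_edge x p,
    last x p \in V :\: [set a; b] /\ E (last x p) b
    & forall t, t \in x :: p -> 0 < ev g t].
Proof.
move=> uab Eab; have aup : upper a.
  by move=> e y eV _ uea; have := min_a eV; rewrite leNgt uea.
have [y [c [Eay yup yE cmax]]] := upper_step aV bV uab aup.
have [_ yV uay] := E_lt Eay.
have nyb : y != b.
  apply/eqP => yb; rewrite yb in yE Eay; move: yE; rewrite Eab // ga subrr.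
  move/esym/eqP; rewrite mulf_eq0 subr_eq0 (gt_eqF uab) orbF => /eqP c_0.
  by have := cmax c0 c0V; rewrite c_0 mul0r ga subr0 leNgt gc0.
have yI : y \in V :\: [set a; b].
  rewrite !inE negb_or nyb yV !andbT; apply: contraTneq uay => ->.
  by rewrite ltxx.
by have [p [yp lI lb gp]] := upper_path yI yup; exists y, p; split.
Qed.

End UpperHull.

Variable d : nat.
Hypothesis d_gt0 : (0 < d)%N.
Hypothesis full_dim : forall A : {set U}, A \subset V -> (#|A| <= d)%N ->
  exists g, (forall e, e \in A -> ev g e = 0) /\
            exists2 e, e \in V & ev g e != 0.

(** The Holt-Klee theorem, for a polytope of dimension at least [d] in the
    hyperplane [z = 1] whose vertices are the vectors indexed by [V]: [full_dim]
    says that [d] points of [V] always lie in a hyperplane that does not contain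
    [V]. *)
Theorem polytope_holt_klee : holt_klee V E d.
Proof.
have [g0 [_ [e0 e0V _]]] : exists g, (forall e, e \in set0 -> ev g e = 0) /\
            exists2 e, e \in V & ev g e != 0.
  by apply: full_dim; rewrite ?sub0set ?cards0.
have [a aV min_a] : exists2 a, a \in V & forall e, e \in V -> ev u a <= ev u e.
  by case: (@arg_minP _ _ _ e0 [in V] (ev u) e0V) => a aV amin; exists a.
have [b bV max_b] : exists2 b, b \in V & forall e, e \in V -> ev u e <= ev u b.
  by case: (@arg_maxP _ _ _ e0 [in V] (ev u) e0V) => b bV bmax; exists b.
have uab : ev u a < ev u b.
  rewrite lt_neqAle min_a // andbT; apply/eqP => uab.
  have [||g [ga [e eV ge]]] := full_dim (A := [set a]).
  - by rewrite sub1set.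
  - by rewrite cards1.
  case/eqP: ge; rewrite (u_inj (x := e) (y := a)) ?ga ?set11 //.
  by apply/eqP; rewrite eq_le min_a // {1}uab max_b.
have nab : a != b by apply: contraTneq uab => ->; rewrite ltxx.
exists a, b; split.
- apply/setP => x; rewrite !inE; apply/andP/eqP => [[xV /forall_inP noin]|->].
    apply: u_inj => //; apply/eqP; rewrite eq_le min_a // andbT leNgt.
    by apply/negP => /(gt_has_in xV aV)[y /noin/negP].
  split=> //; apply/forall_inP => y yV; apply/negP => /E_lt[_ _].
  by rewrite ltNge min_a.
- apply/setP => x; rewrite !inE; apply/andP/eqP => [[xV /forall_inP noout]|->].
    apply: u_inj => //; apply/eqP; rewrite eq_le max_b //= leNgt.
    by apply/negP => /(lt_has_out xV bV)[y /noout/negP].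
  split=> //; apply/forall_inP => y yV; apply/negP => /E_lt[_ _].
  by rewrite ltNge max_b.
pose I := V :\: [set a; b].
have [|X [P [[sXA XP dP] cX]]] := @menger _ (inner_edge a b)
    [set x in I | E a x] [set y in I | E y b] (d - E a b)%N.
  (* The hyperplane passes through [b] when the path has to avoid the edge from
     [a] to [b]. *)
  move=> S ltS; pose A := (a |: (if E a b then [set b] else set0)) :|: (S :&: V).
  have AV : A \subset V.
    apply/subsetP => e; rewrite !inE => /orP[/orP[/eqP->//|]|/andP[]//].
    by case: ifP; rewrite !inE // => _ /eqP->.
  have cA : (#|A| <= d)%N.
    apply: leq_trans (leq_card_setU _ _) _.
    apply: (@leq_trans ((E a b).+1 + #|S|)%N).
      apply: leq_add; last exact/subset_leq_card/subsetIl.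
      apply: leq_trans (leq_card_setU _ _) _.
      by rewrite cards1 add1n ltnS; case: (E a b); rewrite ?cards1 ?cards0.
    by move: ltS d_gt0; rewrite addSn ltn_subRL.
  have [g1 [g1A [c1 c1V g1c1]]] := full_dim AV cA.
  (* Up to sign, [b] is not below the hyperplane and some vertex is above. *)
  have [g [gA gb [c cV gc]]] : exists g, [/\ forall e, e \in A -> ev g e = 0,
      0 <= ev g b & exists2 c, c \in V & 0 < ev g c].
    have gN e : e \in A -> ev (- g1) e = 0 by move=> eA; rewrite evE g1A ?oppr0.
    case: (ltgtP (ev g1 b) 0) => [gb|gb|gb].
    - exists (- g1); split=> //; first by rewrite evE oppr_ge0 ltW.
      by exists b => //; rewrite evE oppr_gt0.
    - by exists g1; split=> //; [exact: ltW | exists b].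
    move: g1c1; rewrite neq_lt => /orP[gc|gc].
      exists (- g1); split=> //; first by rewrite evE gb oppr0.
      by exists c1 => //; rewrite evE oppr_gt0.
    by exists g1; split=> //; [rewrite gb | exists c1].
  have [||x [p [xI ax xp [lI lb] gp]]] :=
    @upper_path_from g a b c aV bV cV _ gb gc min_a max_b uab.
  - by apply: gA; rewrite !inE eqxx.
  - by move=> Eab; apply: gA; rewrite !inE Eab inE eqxx orbT.
  exists x, p; split=> //; [by rewrite inE xI ax | by rewrite inE lI lb |].
  move=> t tp; apply/negP => tS; have := gp t tp; rewrite gA ?ltxx // !inE tS.
  suff -> : t \in V by rewrite !orbT.
  have tI : t \in I.
    exact: inner_path xp xI t tp.
  by move: tI; rewrite inE => /andP[].
(* The path through [x :: P x], without its first vertex [a]. *)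
pose f x := rcons (x :: P x) b.
have sizeX : size ((if E a b then [:: [:: b]] else [::])
                   ++ [seq f x | x <- enum X]) == d.
  rewrite size_cat size_map -cardE cX.
  by case: (E a b); rewrite /= ?add0n ?subn0 // add1n subn1 prednK.
have XI x t : x \in X -> t \in x :: P x -> t \in I.
  move=> xX; have [xp _] := XP x xX.
  have : x \in I by have := subsetP sXA x xX; rewrite inE => /andP[].
  by move=> xI; apply: inner_path xp xI t.
exists (Tuple sizeX); split.
- rewrite /= cat_uniq; apply/and3P; split.
  + by case: (E a b).
  + apply/hasPn => _ /mapP[x _ ->]; case: (E a b) => //.
    by rewrite inE /f; apply/eqP => /(congr1 size); rewrite size_rcons.
  + rewrite map_inj_in_uniq ?enum_uniq // => x y _ _ /rcons_inj[].
    by [].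
- move=> p; rewrite mem_cat => /orP[|/mapP[x]].
    case: ifP => // Eab; rewrite inE => /eqP->; split=> //=; rewrite ?Eab //.
      by rewrite inE nab.
    by move=> t; rewrite !inE => /orP[]/eqP->.
  rewrite mem_enum => xX ->; have [xp] := XP x xX; rewrite inE => /andP[lI lb].
  have xA := subsetP sXA x xX.
  have pth : path E a (f x).
    rewrite /f /= rcons_path lb andbT; move: xA; rewrite inE => /andP[_ ->] /=.
    by apply: sub_path xp => s t /and3P[].
  split=> //; first by rewrite /f /= last_rcons.
    apply: (@sorted_uniq _ (fun s t => ev u s < ev u t)) => [s t r|s|].
    - exact: lt_trans.
    - exact: ltxx.
    - by apply: sub_path pth => s t /E_lt[].
  move=> t; rewrite inE => /orP[/eqP->//|]; rewrite /f mem_rcons inE.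
  by case/orP=> [/eqP->//|/(XI _ _ xX)]; rewrite inE => /andP[].
move=> p q x; rewrite !mem_cat.
have dir r t : r \in (if E a b then [:: [:: b]] else [::]) -> t \in a :: r ->
    t = a \/ t = b.
  by case: ifP => // _; rewrite inE => /eqP->; rewrite !inE => /orP[]/eqP; auto.
move=> /orP[pd _ _ xp _|/mapP[s]]; first exact: dir xp.
rewrite mem_enum => sX -> /orP[qd _ _ xq|/mapP[t]]; first exact: dir xq.
rewrite mem_enum => tX -> nst; rewrite !(inE, mem_rcons).
have [->|nxa] := eqVneq x a; first by left.
have [->|nxb] := eqVneq x b; first by right.
rewrite /= => xs xt; case/eqP: nst; congr f.
by apply: (dP s t x); rewrite ?inE.
Qed.

End HoltKlee.

(** * Realizations and minors *)

(** The columns of [cokermx A] span the right kernel of [A]. *)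
Lemma mulmx_coker_ex (F : fieldType) m n (A : 'M[F]_(m, n)) (x : 'cV[F]_n) :
  A *m x = 0 -> exists y, x = cokermx A *m y.
Proof.
move=> Ax0; have : (x^T <= kermx A^T)%MS.
  by apply/sub_kermxP; rewrite -trmx_mul Ax0 trmx0.
have kE : (kermx A^T <= (cokermx A)^T)%MS.
  have sub : ((cokermx A)^T <= kermx A^T)%MS.
    by apply/sub_kermxP; rewrite -trmx_mul mulmx_coker trmx0.
  rewrite -(geq_leqif (mxrank_leqif_sup sub)).
  by rewrite mxrank_ker !mxrank_tr mxrank_coker.
move=> /submx_trans/(_ kE)/submxP[y yE]; exists y^T.
by rewrite -[LHS]trmxK yE trmx_mul trmxK.
Qed.

Section Sign.
Variable R : realType.
Implicit Type x : R.

Lemma sign_of0 : sign_of (0 : R) = Zero.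
Proof. by rewrite /sign_of eqxx. Qed.

Lemma sign_of_eq0 x : (sign_of x == Zero) = (x == 0).
Proof. by rewrite /sign_of; case: (x == 0) => //; case: ifP. Qed.

Lemma sign_of_eqPos x : (sign_of x == Pos) = (0 < x).
Proof. by rewrite /sign_of; case: (ltgtP 0 x). Qed.

Lemma sign_of_eqNeg x : (sign_of x == Neg) = (x < 0).
Proof. by rewrite /sign_of; case: (ltgtP 0 x). Qed.

Lemma sign_of_ge0 x : (sign_of x \in [:: Zero; Pos]) = (0 <= x).
Proof. by rewrite !inE sign_of_eq0 sign_of_eqPos le_eqVlt eq_sym. Qed.

Lemma sign_ofN x : sign_of (- x) = oppsign (sign_of x).
Proof. by rewrite /sign_of oppr_eq0 oppr_gt0; case: (ltgtP 0 x). Qed.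

Lemma sign_ofM c x : 0 < c -> sign_of (c * x) = sign_of x.
Proof. by move=> c0; rewrite /sign_of mulf_eq0 gt_eqF //= pmulr_rgt0. Qed.

End Sign.

Section Realization.
Variables (R : realType) (U : finType).
Implicit Types (N : oriented_matroid U) (A B I : {set U}).

(** The sign vector on the ground set of [N] of the functional [x]. *)
Definition sign_vector n (v : U -> 'rV[R]_n) N (x : 'cV[R]_n) :=
  [ffun e => if e \in ground N then sign_of (value v x e) else Zero].

(** The vectors [v e] realize [N], in a space of any dimension: unlike the rank,
    the dimension [n] does not change when a minor is taken. *)
Definition realizes n (v : U -> 'rV[R]_n) N : Prop :=
  forall X, X \in covectors N <-> exists x, X = sign_vector v N x.

Lemma representable_realizes N :
  representable R N -> exists n (v : U -> 'rV[R]_n), realizes v N.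
Proof.
case=> v vN; exists (rank N), v => X; rewrite vN; split=> -[x ->].
  exists x^T; apply/ffunP => e; rewrite !ffunE /value mxE.
  by under [in RHS]eq_bigr do rewrite mxE.
exists x^T; apply/ffunP => e; rewrite !ffunE /value mxE.
by under [in RHS]eq_bigr do rewrite mxE.
Qed.

Lemma reorientation_realizes n (v : U -> 'rV[R]_n) N (A : {set U}) :
  realizes v N ->
  realizes (fun e => if e \in A then - v e else v e) (reorientation N A).
Proof.
move=> vN; have flipE x : flip A (sign_vector v N x) =
    sign_vector (fun e => if e \in A then - v e else v e) (reorientation N A) x.
  apply/ffunP => e; rewrite !ffunE /= /value.
  case: (e \in A); case: (e \in ground N) => //.
  by rewrite mulNmx [in RHS]mxE sign_ofN.
move=> X; split=> [/imsetP[Y /vN[x ->] ->]|[x ->]]; first by exists x.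
by apply/imsetP; exists (sign_vector v N x) => //; apply/vN; exists x.
Qed.

Lemma deletion_realizes n (v : U -> 'rV[R]_n) N A :
  realizes v N -> realizes v (deletion N A).
Proof.
move=> vN; have eraseE x :
    erase A (sign_vector v N x) = sign_vector v (deletion N A) x.
  by apply/ffunP => e; rewrite !ffunE /= inE; case: (e \in A).
move=> X; split=> [/imsetP[Y /vN[x ->] ->]|[x ->]]; first by exists x.
by apply/imsetP; exists (sign_vector v N x) => //; apply/vN; exists x.
Qed.

Section Span.
Variables (n : nat) (v : U -> 'rV[R]_n).

(** A square matrix whose row space is spanned by the vectors of [A]. *)
Definition span (A : {set U}) : 'M[R]_n := (\sum_(e in A) <<v e>>)%MS.

Lemma mem_span A e : e \in A -> (v e <= span A)%MS.
Proof. by move=> eA; apply: (sumsmx_sup e); rewrite ?genmxE. Qed.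

Lemma span_sub A B : A \subset B -> (span A <= span B)%MS.
Proof.
move/subsetP=> sAB; apply/sumsmx_subP => e /sAB; rewrite genmxE.
exact: mem_span.
Qed.

Lemma span_annihilates A x :
  (span A *m x = 0) <-> (forall e, e \in A -> value v x e = 0).
Proof.
split=> [/sub_kermxP/sumsmx_subP sA e /sA|xA].
  by rewrite genmxE => /sub_kermxP; rewrite /value => ->; rewrite mxE.
apply/sub_kermxP/sumsmx_subP => e /xA; rewrite genmxE /value => xe.
by apply/sub_kermxP/rowP => i; rewrite ord1 xe mxE.
Qed.

(** A vector outside a span is separated from it by a functional. *)
Lemma span_separates A e : ~~ (v e <= span A)%MS ->
  exists x, (forall f, f \in A -> value v x f = 0) /\ value v x e != 0.
Proof.
rewrite submxE => /rV0Pn[i xi].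
exists (cokermx (span A) *m delta_mx i 0); split.
  by apply/span_annihilates; rewrite mulmxA mulmx_coker mul0mx.
by rewrite /value mulmxA -colE mxE.
Qed.

Lemma rank_span_le A : (\rank (span A) <= #|A|)%N.
Proof.
rewrite -sum1_card /span; elim/big_rec2: _ => [|e B m _ le_m].
  by rewrite mxrank0.
apply: leq_trans (mxrank_adds_leqif _ _) _; rewrite leq_add //.
by rewrite genmxE rank_leq_row.
Qed.

Lemma span_setU1 e A : (span (e |: A) :=: v e + span A)%MS.
Proof.
apply/eqmxP/andP; split.
  apply/sumsmx_subP => f; rewrite genmxE in_setU1 => /orP[/eqP->|fA].
    exact: addsmxSl.
  exact: submx_trans (mem_span fA) (addsmxSr _ _).
by rewrite addsmx_sub mem_span ?setU11 // span_sub // subsetU1.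
Qed.

Lemma rank_span_setU1 e A : ~~ (v e <= span A)%MS ->
  \rank (span (e |: A)) = (\rank (span A)).+1.
Proof.
move=> eA; apply/eqP; rewrite eqn_leq; apply/andP; split.
  rewrite span_setU1; apply: leq_trans (mxrank_adds_leqif _ _) _.
  by rewrite -[leqRHS]add1n leq_add2r rank_leq_row.
have : (span A < span (e |: A))%MS.
  rewrite ltmxE span_sub ?subsetU1 //=; apply: contra eA.
  by apply: submx_trans; rewrite mem_span ?setU11.
by rewrite ltmxErank => /andP[].
Qed.

Lemma span_not_sub A B : (\rank (span A) < \rank (span B))%N ->
  exists2 e, e \in B & ~~ (v e <= span A)%MS.
Proof.
move=> ltAB; have [/forall_inP BA|] := boolP [forall e in B, (v e <= span A)%MS].
  move: ltAB; rewrite ltnNge mxrankS //.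
  by apply/sumsmx_subP => e /BA; rewrite genmxE.
by rewrite negb_forall_in => /exists_inP[e]; exists e.
Qed.

End Span.

(** Multiplying by [cokermx] restricts the functionals to those that vanish on
    the contracted elements. *)
Lemma contraction_realizes n (v : U -> 'rV[R]_n) N A : realizes v N ->
  realizes (fun e => v e *m cokermx (span v (A :&: ground N))) (contraction N A).
Proof.
set K := cokermx _ => vN.
have KE y : (forall e, e \in A -> sign_vector v N (K *m y) e = Zero) /\
    sign_vector v N (K *m y) =
    sign_vector (fun e => v e *m K) (contraction N A) y.
  have K0 e : e \in A -> sign_vector v N (K *m y) e = Zero.
    move=> eA; rewrite ffunE; case: ifP => // eN.
    have /span_annihilates -> : span v (A :&: ground N) *m (K *m y) = 0.
    - by rewrite mulmxA mulmx_coker mul0mx.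
    - exact: sign_of0.
    - by rewrite inE eA.
  split=> //; apply/ffunP => e; have := K0 e; rewrite !ffunE /= inE.
  by case: (e \in A) => /= [->//|_]; rewrite /value mulmxA.
move=> X; split=> [/vanishingP[/vN[x ->] xA]|[y ->]].
  have [y yE] : exists y, x = K *m y.
    apply: mulmx_coker_ex; apply/span_annihilates => e.
    rewrite inE => /andP[eA eN].
    by have /eqP := xA e eA; rewrite ffunE eN sign_of_eq0 => /eqP.
  by exists y; rewrite yE; have [_ ->] := KE y.
have [K0 <-] := KE y; apply/vanishingP; split=> //.
by apply/vN; exists (K *m y).
Qed.

Lemma reduces_realizes M N : reduces_to M N -> representable R M ->
  exists n (v : U -> 'rV[R]_n), realizes v N.
Proof.
move=> MN; elim: MN => [|N' A _ IH|N' A _ IH|N' A _ IH] /=.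
- exact: representable_realizes.
- by move=> /IH[n [v vN]]; eexists; eexists; apply: reorientation_realizes vN.
- by move=> /IH[n [v vN]]; eexists; eexists; apply: deletion_realizes vN.
- by move=> /IH[n [v vN]]; eexists; eexists; apply: contraction_realizes vN.
Qed.

Section Rank.
Variables (n : nat) (v : U -> 'rV[R]_n) (N : oriented_matroid U).
Hypothesis vN : realizes v N.

Lemma covector_sign_vector x : sign_vector v N x \in covectors N.
Proof. by apply/vN; exists x. Qed.

Lemma zero_set_sign_vector x :
  zero_set N (sign_vector v N x) = [set e in ground N | value v x e == 0].
Proof.
apply/setP => e; rewrite !inE ffunE.
by case: (e \in ground N); rewrite ?sign_of_eq0.
Qed.

Lemma flat_closureE A e : A \subset ground N -> e \in ground N ->
  (e \in flat_closure N A) = (v e <= span v A)%MS.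
Proof.
move=> /subsetP AN eN; apply/idP/idP => [|eA].
  apply: contraLR => /span_separates[x [xA xe]]; apply/bigcapP.
  move=> /(_ (zero_set N (sign_vector v N x))).
  rewrite zero_set_sign_vector inE eN (negPf xe) => H; suff : false by [].
  apply: H; rewrite -zero_set_sign_vector imset_f ?covector_sign_vector //.
  rewrite zero_set_sign_vector; apply/subsetP => f fA.
  by rewrite inE AN //= xA.
apply/bigcapP => _ /andP[/imsetP[_ /vN[x ->] ->]].
rewrite zero_set_sign_vector => /subsetP Ax; rewrite inE eN /=.
have /sub_kermxP : (v e <= kermx x)%MS.
  apply: submx_trans eA _; apply/sub_kermxP/span_annihilates => f /Ax.
  by rewrite inE => /andP[_ /eqP].
by rewrite /value => ->; rewrite mxE.
Qed.

Lemma independentE (I : {set U}) : independent N I =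
  (I \subset ground N) && [forall e in I, ~~ (v e <= span v (I :\ e))%MS].
Proof.
rewrite /independent; case: (boolP (I \subset ground N)) => //= IN.
apply: eq_forallb_in => e eI; rewrite flat_closureE ?(subsetP IN) //.
exact: subset_trans (subsetDl _ _) IN.
Qed.

Lemma rank_independent I : independent N I -> \rank (span v I) = #|I|.
Proof.
rewrite independentE => /andP[_ /forall_inP]; have [m] := ubnP #|I|.
elim: m I => // m IHm I; rewrite ltnS => le_m Iind.
have [->|[e eI]] := set_0Vmem I; first by rewrite /span big_set0 mxrank0 cards0.
have eN := Iind e eI; rewrite -(setD1K eI) rank_span_setU1 // IHm.
- by rewrite cardsU1 !inE eqxx.
- by apply: leq_trans le_m; rewrite (cardsD1 e I) eI.
move=> f; rewrite 2!inE => /andP[nfe fI]; apply: contra (Iind f fI).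
by move=> /submx_trans; apply; rewrite span_sub // setSD // subsetDl.
Qed.

(** The rank of a set of elements is the rank of the vectors. *)
Lemma rank_ofE A : A \subset ground N -> rank_of N A = \rank (span v A).
Proof.
move=> AN; apply/eqP; rewrite eqn_leq; apply/andP; split.
  apply/bigmax_leqP => I /andP[IA Iind].
  by rewrite -rank_independent // mxrankS // span_sub.
have [I /minsetP[AI minI] IA] :=
  @minset_exists _ (fun I => (span v A <= span v I)%MS) A (submx_refl _).
have Iind : independent N I.
  rewrite independentE (subset_trans IA AN); apply/forall_inP => e eI.
  apply/negP => eIe; have := minI (I :\ e) _ (subsetDl _ _).
  have sub : (span v I <= span v (I :\ e))%MS.
    by rewrite -{1}(setD1K eI) span_setU1 addsmx_sub eIe submx_refl.
  move/(_ (submx_trans AI sub))/setP/(_ e); rewrite !inE eqxx eI //.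
apply: (@leq_trans #|I|); first by rewrite -rank_independent // mxrankS.
by apply: leq_bigmax_cond; rewrite IA.
Qed.

End Rank.

End Realization.

(** * Proper coline fixations of realized oriented matroids *)

Section Fixation.
Variables (R : realType) (U : finType) (n : nat) (v : U -> 'rV[R]_n).
Variables (N : oriented_matroid U) (T : {set U}).
Hypothesis vN : realizes v N.
Hypothesis coT : coline N T.
Hypothesis propT : proper_fixation N T.
Let V := ground N :\: T.
Local Notation ev := (value v).
Local Notation sv := (sign_vector v N).

Lemma sign_vectorE x e : e \in ground N -> sv x e = sign_of (ev x e).
Proof. by move=> eN; rewrite ffunE eN. Qed.

Lemma compl_ground e : e \in V -> e \in ground N.
Proof. by rewrite inE => /andP[]. Qed.

Lemma coline_ground : T \subset ground N.
Proof.
have /andP[/imsetP[X _ ->] _] := coT.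
by apply/subsetP => e; rewrite inE => /andP[].
Qed.

Lemma coline_rank : (\rank (span v T)).+2 = \rank (span v (ground N)).
Proof.
have /andP[_ /eqP] := coT.
by rewrite /rank !(rank_ofE vN) ?coline_ground // addn2.
Qed.

Lemma supercellP X :
  reflect (exists2 x, X = sv x & nonneg v V x) (X \in supercell N T).
Proof.
rewrite inE; apply: (iffP andP) => [[/vN[x ->] /forall_inP x0]|[x -> x0]].
  exists x => // e eV; have := x0 e eV.
  by rewrite sign_vectorE ?sign_of_ge0 // compl_ground.
split; first exact: covector_sign_vector.
apply/forall_inP => e eV; rewrite sign_vectorE ?compl_ground // sign_of_ge0.
exact: x0.
Qed.

Lemma faceP f X : f \in V ->
  reflect (exists x, [/\ X = sv x, nonneg v V x & ev x f = 0])
          (X \in face N T f).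
Proof.
move=> fV; rewrite inE.
apply: (iffP andP) => [[/supercellP[x -> x0]]|[x [-> x0 xf]]].
  by rewrite sign_vectorE ?compl_ground // sign_of_eq0 => /eqP xf; exists x.
rewrite sign_vectorE ?compl_ground // sign_of_eq0 xf eqxx; split=> //.
by apply/supercellP; exists x.
Qed.

Lemma mem_face x f : f \in V -> nonneg v V x ->
  (sv x \in face N T f) = (ev x f == 0).
Proof.
move=> fV x0; rewrite inE sign_vectorE ?compl_ground // sign_of_eq0.
by rewrite andb_idl // => _; apply/supercellP; exists x.
Qed.

Lemma supercell_interior : exists z,
  (forall e, e \in V -> 0 < ev z e) /\ (forall e, e \in T -> ev z e = 0).
Proof.
have [_ [_ /supercellP[z -> z0] [zT zV]] _] := propT.
exists z; split=> e eVT; have eN : e \in ground N.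
- exact: compl_ground.
- by rewrite -sign_of_eqPos -sign_vectorE //; move: eVT; rewrite -[V]zV inE.
- exact: (subsetP coline_ground).
move: eVT; rewrite -zT zero_set_sign_vector inE => /andP[_ /eqP] //.
Qed.

Lemma generic_functional f : f \in V -> exists y,
  [/\ ev y f = 0, forall e, e \in T -> ev y e = 0
    & forall e, e \in V -> e != f -> ev y e != 0].
Proof.
move=> fV; have [gen _ _] := propT; have [_ /vN[y ->] [yz _]] := gen f fV.
rewrite zero_set_sign_vector in yz.
have yE e : e \in f |: T -> ev y e = 0 by rewrite -yz inE => /andP[_ /eqP].
exists y; split=> [|e eT|e eV nef].
- by rewrite yE ?setU11.
- by rewrite yE // setU1r.
apply/negP => ye; have : e \in f |: T by rewrite -yz inE compl_ground.
by rewrite !inE (negPf nef) /=; move: eV; rewrite inE => /andP[/negPf->].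
Qed.

(** The functionals that vanish on the coline form a plane, up to those that
    vanish on the ground set; [V] has at least two elements. *)
Lemma coline_plane z : (forall e, e \in V -> 0 < ev z e) ->
    (forall e, e \in T -> ev z e = 0) ->
  exists u f g, [/\ f \in V, g \in V, f != g, forall e, e \in T -> ev u e = 0
    & forall x, (forall e, e \in T -> ev x e = 0) ->
        exists a b, forall e, e \in ground N -> ev x e = a * ev z e + b * ev u e].
Proof.
move=> zV zT; have rT := coline_rank.
have [f fN fT] : exists2 f, f \in ground N & ~~ (v f <= span v T)%MS.
  by apply: span_not_sub; rewrite -rT.
have rfT := rank_span_setU1 fT.
have [g gN gT] : exists2 g, g \in ground N & ~~ (v g <= span v (f |: T))%MS.
  by apply: span_not_sub; rewrite -rT rfT.
have rgfT := rank_span_setU1 gT.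
have sub A e : ~~ (v e <= span v A)%MS -> e \notin A.
  by apply: contra => /mem_span.
have fV : f \in V by rewrite inE fN sub.
have := sub _ _ gT; rewrite in_setU1 negb_or => /andP[ngf gTN].
have gV : g \in V by rewrite inE gN gTN.
have [u [uf uT uV]] := generic_functional fV.
exists u, f, g; split=> //; first by rewrite eq_sym.
move=> x xT; pose a := ev x f / ev z f; pose b := (ev x g - a * ev z g) / ev u g.
exists a, b => e eN; apply/eqP; rewrite -subr_eq0 opprD addrA; apply/eqP.
have evy e' : ev (x - a *: z - b *: u) e' = ev x e' - a * ev z e' - b * ev u e'.
  by rewrite !evE.
rewrite -evy; have sE : (span v (ground N) <= span v (g |: (f |: T)))%MS.
  have sub' : (span v (g |: (f |: T)) <= span v (ground N))%MS.
    by rewrite span_sub // !subUset !sub1set gN fN coline_ground.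
  by rewrite -(geq_leqif (mxrank_leqif_sup sub')) rgfT rfT rT.
have : span v (g |: (f |: T)) *m (x - a *: z - b *: u) = 0.
  apply/span_annihilates => h; rewrite !inE evy.
  case/or3P=> [/eqP->|/eqP->|hT]; last by rewrite xT // zT // uT // !mulr0 !subr0.
    by rewrite [b * _]divfK ?subrr // uV.
  by rewrite uf mulr0 subr0 [a * _]divfK ?subrr // gt_eqF // zV.
move/sub_kermxP => /(submx_trans sE)/sub_kermxP/span_annihilates; exact.
Qed.

Section Polytope.
Variables (z u : 'cV[R]_n).
Hypothesis zV : forall e, e \in V -> 0 < ev z e.
Hypothesis zT : forall e, e \in T -> ev z e = 0.
Hypothesis uT : forall e, e \in T -> ev u e = 0.
Hypothesis plane : forall x, (forall e, e \in T -> ev x e = 0) ->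
  exists a b, forall e, e \in ground N -> ev x e = a * ev z e + b * ev u e.

(** The vertices of the polar of the supercell, in the hyperplane [z = 1], for
    [e] in [V]. *)
Definition vertex e : 'rV[R]_n := (ev z e)^-1 *: v e.
Local Notation ew := (value vertex).

Lemma ev_vertex x e : ew x e = ev x e / ev z e.
Proof. by rewrite /value /vertex -scalemxAl mxE mulrC. Qed.

Lemma ev_vertexK x e : e \in V -> ev x e = ev z e * ew x e.
Proof. by move=> eV; rewrite ev_vertex mulrC divfK // gt_eqF ?zV. Qed.

Lemma vertex1 e : e \in V -> ew z e = 1.
Proof. by move=> eV; rewrite ev_vertex divff // gt_eqF ?zV. Qed.

Lemma nonneg_vertex x : nonneg vertex V x <-> nonneg v V x.
Proof.
split=> x0 e eV; last by rewrite ev_vertex divr_ge0 ?x0 // ltW ?zV.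
by rewrite ev_vertexK // mulr_ge0 ?x0 // ltW ?zV.
Qed.

Lemma ev_vertex_eq0 x e : e \in V -> (ew x e == 0) = (ev x e == 0).
Proof. by move=> eV; rewrite ev_vertexK // mulf_eq0 (gt_eqF (zV eV)). Qed.

Lemma u_inj : {in V &, injective (ew u)}.
Proof.
move=> e f eV fV uef; apply/eqP/negPn/negP => nef.
have [y [ye yT yV]] := generic_functional eV.
have [a [b yE]] := plane yT.
have yE' h : h \in V -> ew y h = a + b * ew u h.
  move=> hV; rewrite ev_vertex yE ?compl_ground //.
  rewrite ev_vertex mulrDl mulrA mulfK //.
  by rewrite gt_eqF ?zV.
have : ew y f == 0 by rewrite yE' // -uef -yE' // ev_vertex_eq0 // ye.
by rewrite ev_vertex_eq0 // (negPf (yV f fV _)) // eq_sym.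
Qed.

(** Every [vertex a] is a vertex: the vertices of the smallest face containing
    it have the same facet of the supercell, hence the same smallest face, while
    the minimum of [u] on this face is a vertex of the polytope. *)
Lemma vertex_exposed a : a \in V -> exposed vertex V a.
Proof.
move=> aV; pose P m := `[< exists p, [/\ nonneg vertex V p, a \in zeros vertex V p
  & #|zeros vertex V p| = m] >].
have exP : exists m, P m.
  exists #|zeros vertex V 0|; apply/asboolP; exists 0.
  split=> // [e _|]; first by rewrite /value mulmx0 mxE.
  by rewrite inE aV /value mulmx0 mxE eqxx.
case: (ex_minnP exP) => m /asboolP[p [p0 ap <-]] pmin {exP}.
have minp q : nonneg vertex V q -> ew q a = 0 ->
    zeros vertex V p \subset zeros vertex V q.
  move=> q0 qa; have [|r r0 rE] := subface p0 (g := q).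
    by move=> e; rewrite inE => /andP[eV _]; apply: q0.
  have := pmin #|zeros vertex V r|; rewrite rE => le_p.
  apply/setIidPl/eqP; rewrite eqEcard subsetIl le_p //; apply/asboolP.
  by exists r; rewrite rE; split=> //; rewrite inE ap inE aV qa eqxx.
have same f : f \in zeros vertex V p -> face N T f = face N T a.
  rewrite inE => /andP[fV pf]; have [_ _ /(_ a aV)] := propT.
  rewrite inE => /maxsetP[_]; apply; first exact: imset_f.
  apply/subsetP => X /(faceP _ aV)[x [-> x0 xa]]; rewrite mem_face //.
  have := minp x; rewrite nonneg_vertex => /(_ x0) /=.
  rewrite -ev_vertex_eq0 // ev_vertex xa mul0r => /(_ erefl)/subsetP/(_ f).
  by rewrite !in_zeros fV pf => /(_ isT).
have [f0 f0p minf0] : exists2 f, f \in zeros vertex V p &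
    forall e, e \in zeros vertex V p -> ew u f <= ew u e.
  by case: (@arg_minP _ _ _ a [in zeros vertex V p] (ew u) ap) => f; exists f.
have f0V : f0 \in V by move: f0p; rewrite inE => /andP[].
have gE e : e \in V -> ew (u - ew u f0 *: z) e = ew u e - ew u f0.
  by move=> eV; rewrite !evE vertex1 // mulr1.
have [|y y0 yE] := subface p0 (g := u - ew u f0 *: z).
  move=> e ep; move: (ep); rewrite inE => /andP[eV _].
  by rewrite gE // subr_ge0 minf0.
have {}yE : zeros vertex V y = [set f0].
  rewrite yE; apply/setP => e; rewrite in_setI !in_zeros in_set1.
  case: (boolP (e \in V)) => /= eV.
    rewrite gE // subr_eq0; apply/andP/eqP => [[_ /eqP/u_inj->//]|->].
    by move: f0p; rewrite inE eqxx => /andP[].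
  by symmetry; apply: contraNF eV => /eqP->.
have y0' : nonneg v V y by apply/nonneg_vertex.
have ya : ew y a = 0.
  apply/eqP; rewrite ev_vertex_eq0 // -mem_face // -(same f0 f0p) mem_face //.
  rewrite -ev_vertex_eq0 //; have : f0 \in zeros vertex V y by rewrite yE set11.
  by rewrite inE => /andP[].
have : a \in zeros vertex V y by rewrite inE aV ya eqxx.
by rewrite yE inE => /eqP ->; exists y.
Qed.

Lemma edge_adjacent x y q : x \in V -> y \in V -> nonneg vertex V q ->
  zeros vertex V q = [set x; y] -> x != y -> adjacent N T x y.
Proof.
move=> xV yV q0 Zq nxy; have [_ _ facetsE] := propT.
have q0' : nonneg v V q by apply/nonneg_vertex.
have mem_q e : e \in V -> (sv q \in face N T e) = (e \in [set x; y]).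
  by move=> eV; rewrite mem_face // -ev_vertex_eq0 // -Zq inE eV.
apply/maxsetP; split.
  apply/exists_inP; exists (face N T x); first exact: facetsE.
  apply/exists_inP; exists (face N T y); first exact: facetsE.
  rewrite eqxx andbT; apply/eqP => /setP xyE.
  have [p p0 Zp] := vertex_exposed xV.
  have p0' : nonneg v V p by apply/nonneg_vertex.
  have mem_p e : e \in V -> (sv p \in face N T e) = (e == x).
    by move=> eV; rewrite mem_face // -ev_vertex_eq0 // -in_set1 -Zp inE eV.
  by have := xyE (sv p); rewrite !mem_p // eqxx eq_sym (negPf nxy).
move=> _ /exists_inP[F + /exists_inP[G + /andP[nFG /eqP->]]].
rewrite !inE => /maxsetP[/imsetP[e eV FE] _] /maxsetP[/imsetP[f fV GE] _].
rewrite {}FE {}GE in nFG * => /subsetP/(_ (sv q)).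
have nef : e != f by apply: contraNneq nFG => ->.
rewrite !in_setI !mem_q // !in_set2 !eqxx !orbT => /(_ isT).
case/andP=> /orP[]/eqP eE /orP[]/eqP fE; move: nef; rewrite eE fE ?eqxx //.
by rewrite setIC.
Qed.

(** The functional [u - ew u e *: z] vanishes on [T] and at [e], and it takes
    the sign of [ew u f - ew u e] at the other elements [f]. *)
Lemma shelling_functional e f : f \in ground N ->
  ev (u - ew u e *: z) f = if f \in T then 0 else ev z f * (ew u f - ew u e).
Proof.
move=> fN; rewrite !evE; case: (boolP (f \in T)) => fT.
  by rewrite uT // zT // mulr0 subr0.
by rewrite (ev_vertexK u) ?inE ?fT // mulrBr mulrC [ew u e * _]mulrC.
Qed.

(** A functional that vanishes on [T] is determined, up to a factor, by a zero
    in [V]. *)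
Lemma coline_functional x : (forall e, e \in T -> ev x e = 0) ->
  exists b, forall e f, e \in V -> ev x e = 0 -> f \in ground N ->
    ev x f = b * ev (u - ew u e *: z) f.
Proof.
move=> xT; have [a [b xE]] := plane xT; exists b => e f eV xe fN.
have : ew x e = a + b * ew u e.
  rewrite ev_vertex xE ?compl_ground // ev_vertex mulrDl mulrA mulfK //.
  by rewrite gt_eqF ?zV.
rewrite {1}ev_vertex xe mul0r => ab.
have aE : a = - (b * ew u e) by apply/eqP; rewrite -addr_eq0 -ab.
by rewrite xE // !evE aE; ring.
Qed.

Variables (f0 g0 : U).
Hypotheses (f0V : f0 \in V) (g0V : g0 \in V) (nfg0 : f0 != g0).

Lemma shelling_cocircuit e : e \in V -> cocircuit N (sv (u - ew u e *: z)).
Proof.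
move=> eV; have suppE x f :
    (f \in Defs.support (sv x)) = (f \in ground N) && (ev x f != 0).
  by rewrite inE ffunE; case: (f \in ground N); rewrite //= sign_of_eq0.
rewrite /cocircuit covector_sign_vector // andbT; apply/minsetP; split.
  apply/exists_inP; exists (sv (u - ew u e *: z)).
    exact: covector_sign_vector.
  rewrite eqxx andbT; apply/eqP => /ffunP s0.
  have sE f : f \in V -> f = e.
    move=> fV; have /eqP := s0 f.
    rewrite sign_vectorE ?compl_ground // [X in _ == X]ffunE.
    rewrite sign_of_eq0 shelling_functional ?compl_ground // ifN; last first.
      by move: fV; rewrite inE => /andP[].
    by rewrite mulf_eq0 (gt_eqF (zV fV)) subr_eq0 => /eqP/u_inj->.
  by case/eqP: nfg0; rewrite (sE f0) // (sE g0).
move=> _ /exists_inP[_ /vN[y ->] /andP[y0 /eqP->]] /subsetP sub.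
have y_0 f : f \in ground N -> ev (u - ew u e *: z) f = 0 -> ev y f = 0.
  move=> fN xf; apply/eqP; apply: contraT => yf.
  by have := sub f; rewrite !suppE fN yf xf eqxx => /(_ isT).
have ye : ev y e = 0.
  apply: y_0; rewrite ?shelling_functional ?compl_ground // subrr mulr0.
  by rewrite if_same.
have yT f : f \in T -> ev y f = 0.
  move=> fT; have fN := subsetP coline_ground f fT.
  by apply: y_0; rewrite // shelling_functional // fT.
have [b yE] := coline_functional yT.
have b0 : b != 0.
  apply: contraNneq y0 => b0; apply/eqP/ffunP => f; rewrite !ffunE.
  by case: ifP => // fN; rewrite (yE e) // b0 mul0r sign_of0.
apply/setP => f; rewrite !suppE; case: (boolP (f \in ground N)) => //= fN.
by rewrite (yE e) // mulf_eq0 (negPf b0).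
Qed.

Lemma shelling_covectorE s e : e \in V ->
    (forall f, f \in V -> (index f s < index e s)%N = (ew u f < ew u e)) ->
  shelling_covector N T s e = sv (u - ew u e *: z).
Proof.
move=> eV sE; apply/ffunP => f; rewrite !ffunE !inE negb_or.
case: (boolP (f \in ground N)) => [fN|]; last by rewrite andbF.
rewrite shelling_functional // andbT.
case: (boolP (f \in T)) => fT; first by rewrite andbF sign_of0.
have fV : f \in V by rewrite inE fT.
rewrite andbT sign_ofM ?zV // sE //; have [->|nfe] /= := eqVneq f e.
  by rewrite subrr sign_of0.
apply/esym/eqP; case: (ltgtP (ew u f) (ew u e)) => [ufe|uef|/u_inj fe].
- by rewrite sign_of_eqNeg subr_lt0.
- by rewrite sign_of_eqPos subr_gt0.
- by rewrite fe ?eqxx in nfe.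
Qed.

Lemma exists_coline_shelling : exists s, coline_shelling N T s.
Proof.
pose le_u := relpre (ew u) <=%R; pose s := sort le_u (enum V).
have mem_s : s =i V by move=> e; rewrite mem_sort mem_enum.
have us : uniq s by rewrite sort_uniq enum_uniq.
have tr : transitive le_u by move=> y x t; apply: le_trans.
have ss : sorted le_u s by apply: sort_sorted => x y; apply: le_total.
have le_s e f : e \in V -> f \in V -> (index e s < index f s)%N ->
    ew u e < ew u f.
  move=> eV fV ef; have := sorted_ltn_index tr ss; move=> /(_ e f).
  rewrite !mem_s => /(_ eV fV ef).
  rewrite /le_u /= le_eqVlt => /orP[/eqP/u_inj|//].
  by move=> E; rewrite E // ltnn in ef.
exists s; split=> // e; rewrite mem_s => eV.
rewrite shelling_covectorE ?shelling_cocircuit // => f fV.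
apply/idP/idP => [|ufe]; first exact: le_s.
rewrite ltnNge leq_eqVlt negb_or; apply/andP; split.
  apply: contraTneq ufe => ef; rewrite -leNgt.
  by rewrite -(nth_index e (_ : f \in s)) ?mem_s // -ef nth_index ?mem_s.
by apply: contraTN ufe => ef; rewrite -leNgt ltW // le_s.
Qed.

(** A coline shelling lists [V] along [u] or along [- u]. *)
Lemma coline_shelling_order s : coline_shelling N T s ->
  exists2 b : R, b != 0 & forall e f, e \in V -> f \in V ->
    (index f s < index e s)%N = (ew (b *: u) f < ew (b *: u) e).
Proof.
case=> us mem_s sc; have mem_s' e : (e \in s) = (e \in V) by rewrite mem_s.
(* The cocircuit of [e] is that of the functional [u - ew u e *: z], up to the
   factor [b], whose sign decides the direction of the shelling. *)
have slope e : e \in V -> exists b, forall f, f \in V ->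
    ((index f s < index e s)%N -> b * (ew u f - ew u e) < 0) /\
    ((index e s < index f s)%N -> 0 < b * (ew u f - ew u e)).
  move=> eV; have es : e \in s by rewrite mem_s'.
  have /andP[_ /vN[x xE]] := sc e es.
  have {}xE f : f \in ground N -> sign_of (ev x f) =
    if f \in V :\ e then if (index f s < index e s)%N then Neg else Pos else Zero.
    move=> fN; have /ffunP/(_ f) := xE; rewrite [RHS]sign_vectorE // => <-.
    by rewrite ffunE !inE negb_or fN !andbT.
  have x0 f : f \in ground N -> f \notin V :\ e -> ev x f = 0.
    by move=> fN nf; apply/eqP; rewrite -sign_of_eq0 xE // ifN.
  have xT f : f \in T -> ev x f = 0.
    by move=> fT; rewrite x0 ?(subsetP coline_ground) // !inE fT andbF.
  have xe : ev x e = 0 by rewrite x0 ?compl_ground // !inE eqxx.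
  have [b bE] := coline_functional xT; exists b => f fV.
  have fN := compl_ground fV.
  have fT : f \notin T by move: fV; rewrite inE => /andP[].
  have := xE f fN; rewrite (bE e f) // shelling_functional // (negPf fT).
  rewrite mulrCA sign_ofM ?zV // in_setD1 fV andbT.
  have [->|nfe] /= := eqVneq f e; first by rewrite !ltnn.
  case: ltngtP => // ief /eqP; rewrite ?sign_of_eqNeg ?sign_of_eqPos //.
(* The slopes of [e] and of [f0] have the same sign: evaluate the cocircuit of
   each element at the other one. *)
have same_sign d b c : 0 < b * d * (c * d) -> 0 < b * c :> R.
  rewrite mulrACA -expr2 => bcd; rewrite ltNge; apply/negP => bc.
  by have := mulr_le0_ge0 bc (sqr_ge0 d); rewrite leNgt bcd.
have [b bE] := slope f0 f0V.
have same e c : e \in V -> e != f0 -> (forall f, f \in V ->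
    ((index f s < index e s)%N -> c * (ew u f - ew u e) < 0) /\
    ((index e s < index f s)%N -> 0 < c * (ew u f - ew u e))) -> 0 < b * c.
  move=> eV nef /(_ f0 f0V)[c1 c2]; have [b1 b2] := bE e eV.
  case: (ltngtP (index e s) (index f0 s)) => [lt|lt|/index_inj eE].
  - apply: (@same_sign (ew u e - ew u f0)); rewrite nmulr_rgt0 ?b1 //.
    by rewrite -opprB mulrN oppr_lt0 c2.
  - apply: (@same_sign (ew u e - ew u f0)); rewrite pmulr_rgt0 ?b2 //.
    by rewrite -opprB mulrN oppr_gt0 c1.
  - by rewrite eE ?mem_s' ?eqxx // in nef.
have b0 : b != 0.
  apply/eqP => b0.
  have [e eV nef] : exists2 e, e \in V & e != f0 by exists g0; rewrite // eq_sym.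
  by have [c cE] := slope e eV; have := same e c eV nef cE; rewrite b0 mul0r ltxx.
exists b => // e f eV fV; rewrite !evE -subr_lt0 -mulrBr.
have [c [bc cE]] : exists c, 0 < b * c /\ forall f, f \in V ->
    ((index f s < index e s)%N -> c * (ew u f - ew u e) < 0) /\
    ((index e s < index f s)%N -> 0 < c * (ew u f - ew u e)).
  have [->|nef] := eqVneq e f0; first by exists b; rewrite -expr2 exprn_even_gt0.
  by have [c cE] := slope e eV; exists c; split=> //; apply: same nef cE.
have [c1 c2] := cE f fV; set D := ew u f - ew u e in c1 c2 *.
have pos : c * D != 0 -> 0 < b * D * (c * D).
  rewrite mulf_eq0 negb_or => /andP[_ D0].
  by rewrite mulrACA mulr_gt0 // -expr2 exprn_even_gt0.
case: (ltngtP (index f s) (index e s)) => [/c1 cD|/c2 cD|/index_inj eE].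
- by rewrite -(nmulr_lgt0 _ cD) pos // lt_eqF.
- by rewrite ltNge ltW // -(pmulr_lgt0 _ cD) pos // gt_eqF.
- by rewrite /D eE ?mem_s' // subrr mulr0 ltxx.
Qed.

Hypothesis spanT : spanning_complement N T.

Lemma rank_compl : \rank (span v V) = rank N.
Proof. by rewrite -spanT (rank_ofE vN) // subsetDl. Qed.

Lemma shelling_holt_klee s : coline_shelling N T s ->
  holt_klee V (shelling_edge N T s) (rank N - 1).
Proof.
move=> sS; have [us mem_s _] := sS; have [b b0 bE] := coline_shelling_order sS.
have mem_s' e : (e \in s) = (e \in V) by rewrite mem_s.
have rN : rank N = (\rank (span v T)).+2 by rewrite coline_rank -(rank_ofE vN).
apply: (@polytope_holt_klee R U n vertex V z (b *: u)).
- exact: vertex1.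
- exact: vertex_exposed.
- move=> e f eV fV; rewrite !evE => /(mulfI b0); exact: u_inj.
- move=> e f /and4P[]; rewrite !mem_s' => eV fV ef _; split=> //.
  by rewrite -bE.
- move=> e f q eV fV q0 Zq ef; rewrite /shelling_edge !mem_s' eV fV bE // ef /=.
  by apply: edge_adjacent Zq _ => //; apply: contraTneq ef => ->; rewrite ltxx.
- by rewrite rN subn1.
move=> A /subsetP AV cA.
have [e eV eA] : exists2 e, e \in V & ~~ (v e <= span v A)%MS.
  apply: span_not_sub; rewrite rank_compl rN ltnS.
  by apply: leq_trans (rank_span_le _ _) _; move: cA; rewrite rN subn1.
have [g [gA ge]] := span_separates eA.
exists g; split=> [f fA|]; first by rewrite ev_vertex gA // mul0r.
by exists e => //; rewrite ev_vertex_eq0.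
Qed.

End Polytope.

Lemma fixation_HK : spanning_complement N T -> fixation_HK_star N T.
Proof.
move=> spanT; have [z [zV zT]] := supercell_interior.
have [u [f [g [fV gV nfg uT plane]]]] := coline_plane zV zT.
split; first exact: (exists_coline_shelling zV zT uT plane fV gV nfg).
by move=> s; apply: (shelling_holt_klee zV zT uT plane fV gV nfg spanT).
Qed.

End Fixation.

Theorem proposition3 (R : realType) (U : finType) (M : oriented_matroid U) :
  representable R M -> HK_star M.
Proof.
move=> reprM N redN T coT propT spanT.
by have [n [v vN]] := reduces_realizes redN reprM; apply: (fixation_HK vN).
Qed.
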